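(* Let $G$ be a finite-dimensional Lie group with Lie algebra $L(G)$ of left-invariant vector fields, let $\{E_i\}_{1\leq i\leq n}$ be a basis of $L(G)$, let $g$ be the Riemannian metric on $G$ with $g(E_i,E_j)=\delta_{ij}$, and let $\nabla$ be the Levi-Civita connection of $g$. Let $\overline{\nabla},\overset{+}{\nabla},\overset{\circ}{\nabla}$ be the Cartan–Schouten connections, i.e. the linear connections on $G$ determined by $$\overline{\nabla}_{E_i}E_j=0,\qquad \overset{+}{\nabla}_{E_i}E_j=[E_i,E_j],\qquad \overset{\circ}{\nabla}_{E_i}E_j=\tfrac12[E_i,E_j],$$ and set $$\overline{A}=\overline{\nabla}-\overset{\circ}{\nabla},\quad \overset{+}{A}=\overset{+}{\nabla}-\overset{\circ}{\nabla},\quad A=\overset{+}{\nabla}-\overline{\nabla},\quad \overset{+}{A}{}'=\overset{+}{\nabla}-\nabla,\quad A'=\overset{\circ}{\nabla}-\nabla,\quad \overline{A}{}'=\overline{\nabla}-\nabla .$$ Then each of the triples $(G,g,A)$, $(G,g,\overset{+}{A})$, $(G,g,\overline{A})$, $(G,g,\overline{A}{}')$, $(G,g,\overset{+}{A}{}')$, $(G,g,A')$ is a weak Frobenius structure if and only if $$g\left(E_i,[E_j,E_k]\right)=g\left(E_j,[E_k,E_i]\right)\qquad\text{for all }1\leq i,j,k\leq n.$$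
   Context: For a Riemannian metric $g$ on a manifold $M$ and a tensor field $B$ of type $(1,2)$, the triple $(M,g,B)$ is called a weak Frobenius structure if $g(B(X,Y),Z)=g(X,B(Y,Z))$ for all smooth vector fields $X,Y,Z$ on $M$ (no symmetry of $B$ is required). The difference of two linear connections $\nabla^1-\nabla^2$ is the $(1,2)$-tensor field $(X,Y)\mapsto\nabla^1_XY-\nabla^2_XY$. *)

(* Defs.v *)
From HB Require Import structures.
From mathcomp Require Import all_boot all_order all_algebra.
From mathcomp Require Import boolp classical_sets functions cardinality reals.
From mathcomp Require Import interval_inference prodnormedzmodule tvs topology.
From mathcomp Require Import normedtype landau derive.

Set Implicit Arguments.
Unset Strict Implicit.
Unset Printing Implicit Defensive.
Import Order.TTheory GRing.Theory Num.Theory.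
Import numFieldNormedType.Exports.
Local Open Scope classical_set_scope.
Local Open Scope ring_scope.

Lemma near0_differentiable (R : numFieldType) (V W : normedModType R)
    (h : V -> W) (x : V) :
  (\near x, h x = 0) -> differentiable h x.
Proof.
move=> h0; apply/diffP => /=.
apply: (@getPex _ (fun (dh : {linear V -> W}) => continuous dh /\
  forall y, h y = h (lim (nbhs x)) + dh (y - lim (nbhs x))
                  +o_(y \near x) (y - lim (nbhs x)))).
exists (\0 : {linear V -> W}); split; first by move=> y; exact: cst_continuous.
have hx : h (lim (nbhs x)) = 0 by rewrite lim_id// (nbhs_singleton h0).
move=> y; rewrite littleoE /=; first by rewrite addrC subrK.
move=> _/posnumP[e]; near=> z.
rewrite [X in `|X|](_ : _ = 0) ?normr0 ?mulr_ge0//.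
have hz : h z = 0 by near: z.
have E : h z - (h (lim (nbhs x)) + 0) = 0 by rewrite hx addr0 subr0.
exact: E.
Unshelve. all: by end_near. Qed.

Lemma near_eq_differentiable (R : numFieldType) (V W : normedModType R)
    (f g : V -> W) (x : V) :
  (\near x, f x = g x) -> differentiable f x -> differentiable g x.
Proof.
move=> fg df; have -> : g = f + (g - f) by rewrite addrC subrK.
apply: differentiableD => //; apply: near0_differentiable.
near=> y; rewrite [LHS]/(g y - f y); apply/eqP; rewrite subr_eq0 eq_sym.
by apply/eqP; near: y.
Unshelve. all: by end_near. Qed.

Section SmoothOn.
Context {R : realType} {m : nat} {W : normedModType R}.
Implicit Types (U : set 'rV[R]_m) (f g : 'rV[R]_m -> W).

(* Meaningful for U open: values of f outside U are irrelevant. The domain is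
   finite-dimensional, so f is C^(k+1) iff it is differentiable and all its
   directional derivatives are C^k. *)
Fixpoint Ck_on (k : nat) U f : Prop :=
  if k is k'.+1 then
    (forall x, U x -> differentiable f x) /\ (forall v, Ck_on k' U ('D_v f))
  else {within U, continuous f}.

Definition smooth_on U f : Prop := forall k, Ck_on k U f.

Lemma near_open U (P : 'rV[R]_m -> Prop) x :
  open U -> U x -> (forall y, U y -> P y) -> \forall y \near x, P y.
Proof.
by move=> oU Ux UP; apply: filterS UP _; exact: open_nbhs_nbhs.
Qed.

Lemma Ck_on_ext k U f g : open U -> (forall x, U x -> f x = g x) ->
  Ck_on k U f -> Ck_on k U g.
Proof.
move=> oU; elim: k f g => [|k IH] f g fg /=.
  by apply: subspace_eq_continuous => x /set_mem; exact: fg.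
move=> [df dvf]; split.
  by move=> x Ux; apply: near_eq_differentiable (df x Ux);
    exact: near_open Ux fg.
move=> v; apply: IH (dvf v) => x Ux.
by apply: near_eq_derive; exact: near_open Ux fg.
Qed.

Lemma Ck_onW k U f : open U -> Ck_on k.+1 U f -> Ck_on k U f.
Proof.
move=> oU; elim: k f => [|k IH] f [df dvf].
  rewrite /= continuous_open_subspace// => x; rewrite inE => Ux.
  exact/differentiable_continuous/df.
by split=> // v; exact/IH/dvf.
Qed.

Lemma Ck_on_cst k U (a : W) : Ck_on k U (cst a).
Proof.
elim: k a => [|k IH] a /=.
  by apply: continuous_subspaceT => x; exact: cst_continuous.
split=> [x _|v]; first exact: differentiable_cst.
by rewrite (_ : 'D_v _ = cst 0)//; apply/funext => x; rewrite derive_cst.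
Qed.

Lemma Ck_onD k U f g : open U -> Ck_on k U f -> Ck_on k U g ->
  Ck_on k U (f + g).
Proof.
move=> oU; elim: k f g => [|k IH] f g /=.
  by move=> cf cg x; apply: continuousD; [exact: cf|exact: cg].
move=> [df dvf] [dg dvg]; split=> [x Ux|v].
  by apply: differentiableD; [exact: df|exact: dg].
apply: (@Ck_on_ext _ _ ('D_v f + 'D_v g)) => //; last exact: IH.
by move=> x Ux; rewrite deriveD//; apply: diff_derivable; [exact: df|exact: dg].
Qed.

Lemma Ck_onZ k U (a : R) f : open U -> Ck_on k U f -> Ck_on k U (a *: f).
Proof.
move=> oU; elim: k f => [|k IH] f /=.
  by move=> cf x; apply: continuousZr; exact: cf.
move=> [df dvf]; split=> [x Ux|v]; first by apply: differentiableZ; exact: df.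
apply: (@Ck_on_ext _ _ (a *: 'D_v f)) => //; last exact: IH.
by move=> x Ux; rewrite deriveZ//; apply: diff_derivable; exact: df.
Qed.

End SmoothOn.

Lemma Ck_onM (R : realType) m k (U : set 'rV[R]_m) (f g : 'rV[R]_m -> R) :
  open U -> Ck_on k U f -> Ck_on k U g -> Ck_on k U (f * g).
Proof.
move=> oU; elim: k f g => [|k IH] f g.
  by move=> cf cg x; apply: continuousM; [exact: cf|exact: cg].
move=> Cf Cg; have fW := Ck_onW oU Cf; have gW := Ck_onW oU Cg.
case: Cf Cg => df dvf [dg dvg]; split=> [x Ux|v].
  by apply: differentiableM; [exact: df|exact: dg].
apply: (@Ck_on_ext _ _ _ _ _ (f * 'D_v g + g * 'D_v f)) => //; last first.
  by apply: Ck_onD => //; apply: IH => //; [exact: dvg|exact: dvf].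
by move=> x Ux; rewrite deriveM//; apply: diff_derivable; [exact: df|exact: dg].
Qed.

Record chart (R : realType) (m : nat) (M : Type) := Chart {
  chart_dom : set M;
  chart_map : M -> 'rV[R]_m;
  chart_inv : 'rV[R]_m -> M }.

Section Charts.
Context {R : realType}.

Definition chart_im m (M : Type) (c : chart R m M) : set 'rV[R]_m :=
  chart_map c @` chart_dom c.

(* chart_map and chart_inv are total functions, constrained only on chart_dom
   and on chart_im. *)
Definition is_chart m (M : topologicalType) (c : chart R m M) : Prop :=
  [/\ open (chart_dom c), open (chart_im c),
      (forall x, chart_dom c x -> chart_inv c (chart_map c x) = x),
      {within chart_dom c, continuous (chart_map c)} &
      {within chart_im c, continuous (chart_inv c)}].

Definition compatible_charts m (M : Type) (c d : chart R m M) : Prop :=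
  smooth_on (chart_map c @` (chart_dom c `&` chart_dom d))
            (chart_map d \o chart_inv c).

Definition is_atlas m (M : topologicalType) (A : set (chart R m M)) : Prop :=
  [/\ (forall c, A c -> is_chart c),
      (forall x, exists2 c, A c & chart_dom c x) &
      (forall c d, A c -> A d -> compatible_charts c d)].

Definition prod_chart m n (M N : Type) (c : chart R m M) (d : chart R n N) :
    chart R (m + n) (M * N) :=
  Chart (chart_dom c `*` chart_dom d)
        (fun p => row_mx (chart_map c p.1) (chart_map d p.2))
        (fun y => (chart_inv c (lsubmx y), chart_inv d (rsubmx y))).

Definition prod_atlas m n (M N : Type) (A : set (chart R m M))
    (B : set (chart R n N)) : set (chart R (m + n) (M * N)) :=
  [set prod_chart c d | c in A & d in B].

Definition smooth_map m n (M N : topologicalType) (A : set (chart R m M))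
    (B : set (chart R n N)) (F : M -> N) : Prop :=
  continuous F /\
  forall c d, A c -> B d ->
    smooth_on (chart_map c @` (chart_dom c `&` F @^-1` chart_dom d))
              (chart_map d \o F \o chart_inv c).

End Charts.

HB.mixin Record isManifold (R : realType) (m : nat) M of Topological M := {
  atlas : set (chart R m M);
  atlasP : is_atlas atlas;
  manifold_hausdorff : hausdorff_space M;
  manifold_second_countable : @second_countable M }.

#[short(type="manifoldType")]
HB.structure Definition Manifold (R : realType) (m : nat) :=
  { M of isManifold R m M & Topological M }.

HB.mixin Record isLieGroup (R : realType) (m : nat) G
    of Manifold R m G & Group G := {
  smooth_mul : smooth_map (prod_atlas (@atlas R m G) (@atlas R m G))
    (@atlas R m G) (fun p : G * G => (p.1 * p.2)%g);
  smooth_inv : smooth_map (@atlas R m G) (@atlas R m G) (fun x : G => (x^-1)%g)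
}.

#[short(type="lieGroupType")]
HB.structure Definition LieGroup (R : realType) (m : nat) :=
  { G of isLieGroup R m G & Manifold R m G & Group G }.

Section SmoothFunctions.
Context {R : realType} {m : nat} (M : manifoldType R m).

Definition smooth_fun (f : M -> R) : Prop :=
  forall c : chart R m M, atlas c -> smooth_on (chart_im c) (f \o chart_inv c).

Definition smooth_pred : pred (M -> R) := fun f => `[< smooth_fun f >].

Record Cinf := MkCinf {
  Cinf_val :> M -> R;
  Cinf_valP : Cinf_val \in smooth_pred }.

HB.instance Definition _ := [isSub for Cinf_val].
HB.instance Definition _ := [Choice of Cinf by <:].

Lemma chart_im_open (c : chart R m M) : atlas c -> open (chart_im c).
Proof. by case: (@atlasP R m M) => cA _ _ /cA[]. Qed.

Lemma smooth_predP f : reflect (smooth_fun f) (f \in smooth_pred).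
Proof. exact: asboolP. Qed.

Lemma smooth_subring_closed : subring_closed smooth_pred.
Proof.
split=> [|f g|f g].
- by apply/smooth_predP => c _ k; exact: Ck_on_cst.
- move=> /smooth_predP sf /smooth_predP sg; apply/smooth_predP => c Ac k.
  have oc := chart_im_open Ac.
  rewrite (_ : _ \o _ = (f \o chart_inv c) + (-1) *: (g \o chart_inv c)).
    by apply: Ck_onD => //; [exact: sf|apply: Ck_onZ => //; exact: sg].
  by apply/funext => x; rewrite [RHS]/(_ + -1 * _) mulN1r.
- move=> /smooth_predP sf /smooth_predP sg; apply/smooth_predP => c Ac k.
  by apply: Ck_onM (sf c Ac k) (sg c Ac k); exact: chart_im_open.
Qed.

HB.instance Definition _ :=
  GRing.isSubringClosed.Build (M -> R) smooth_pred smooth_subring_closed.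
HB.instance Definition _ := GRing.SubChoice_isSubComPzRing.Build
  (M -> R) smooth_pred Cinf smooth_subring_closed.

Lemma smooth_scaler_closed : GRing.scaler_closed smooth_pred.
Proof.
move=> a f /smooth_predP sf; apply/smooth_predP => c Ac k.
by apply: (Ck_onZ a _ (sf c Ac k)); exact: chart_im_open.
Qed.

HB.instance Definition _ :=
  GRing.isScaleClosed.Build R (M -> R) smooth_pred smooth_scaler_closed.
HB.instance Definition _ := [SubZmodule_isSubLmodule of Cinf by <:].

End SmoothFunctions.

(* Smooth vector fields are the R-linear derivations of the algebra C^oo(M);
   the regular module (Cinf M)^o in the codomain makes f *: X the vector field
   h |-> f * X h. *)
Section VectorFields.
Context {R : realType} {m : nat} (M : manifoldType R m).
Local Notation C := (Cinf M).

Definition derivation (X : C -> C^o) : Prop :=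
  (forall (a : R) (f h : C), X (a *: f + h) = a *: (X f : C) + X h) /\
  (forall f h : C, X (f * h) = X f * h + f * X h).

Definition derivation_pred : pred (C -> C^o) := fun X => `[< derivation X >].

Record vfield := MkVfield {
  vfield_val :> C -> C^o;
  vfield_valP : vfield_val \in derivation_pred }.

HB.instance Definition _ := [isSub for vfield_val].
HB.instance Definition _ := [Choice of vfield by <:].

Lemma derivation_predP X : reflect (derivation X) (X \in derivation_pred).
Proof. exact: asboolP. Qed.

Lemma scalerMC (a : R) (f h : C) : (a *: f) * h = a *: (f * h).
Proof. by apply: val_inj; apply/funext => x; exact/esym/mulrA. Qed.

Lemma scalerCM (a : R) (f h : C) : f * (a *: h) = a *: (f * h).
Proof. by rewrite mulrC scalerMC mulrC. Qed.

Lemma derivation_submod_closed : submod_closed derivation_pred.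
Proof.
split=> [|u X Y].
  apply/derivation_predP; split=> [a f h|f h].
    have z0 : a *: (0 : C) + 0 = 0 by rewrite scaler0 addr0.
    exact: esym z0.
  have z0 : 0 * h + f * 0 = 0 by rewrite mul0r mulr0 addr0.
  exact: esym z0.
move=> /derivation_predP[Xl XL] /derivation_predP[Yl YL].
have E f : (u *: X + Y) f = u * (X f : C) + Y f by [].
apply/derivation_predP; split=> [a f h|f h]; rewrite !E.
  by rewrite Xl Yl mulrDr scalerCM scalerDr addrACA.
by rewrite XL YL !mulrDr !mulrDl !mulrA [f * u]mulrC addrACA.
Qed.

HB.instance Definition _ :=
  GRing.isSubmodClosed.Build C (C -> C^o) derivation_pred
    derivation_submod_closed.
HB.instance Definition _ := [SubChoice_isSubZmodule of vfield by <:].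
HB.instance Definition _ := [SubZmodule_isSubLmodule of vfield by <:].

Lemma vfieldZD (X : vfield) (a : R) (f h : C) :
  X (a *: f + h) = a *: (X f : C) + X h.
Proof. by case/derivation_predP: (vfield_valP X). Qed.

Lemma vfieldM (X : vfield) (f h : C) : X (f * h) = X f * h + f * X h.
Proof. by case/derivation_predP: (vfield_valP X). Qed.

Lemma bracket_derivation (X Y : vfield) :
  (fun f => X (Y f) - Y (X f)) \in derivation_pred.
Proof.
have XD (Z : vfield) f h : Z (f + h) = Z f + Z h.
  by have := vfieldZD Z 1 f h; rewrite !scale1r.
apply/derivation_predP; split=> [a f h|f h].
  by rewrite !vfieldZD scalerBr opprD addrACA.
rewrite !vfieldM !XD !vfieldM mulrBl mulrBr.
rewrite [Y (X f) * h + X f * Y h + _]addrACA opprD addrACA; congr (_ + _).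
  by rewrite opprD addrACA subrr addr0.
by rewrite opprD addrACA subrr add0r.
Qed.

Definition bracket (X Y : vfield) : vfield := MkVfield (bracket_derivation X Y).

End VectorFields.

Section Geometry.
Context {R : realType} {m : nat} (M : manifoldType R m).
Implicit Types (X Y Z : vfield M) (f : Cinf M).

(* The tangent vector X_p, seen as a derivation at p. *)
Definition vf_at X (p : M) : Cinf M -> R := fun f => X f p.

Record riemannian_metric := RiemannianMetric {
  metric_val :> vfield M -> vfield M -> Cinf M;
  metricC : forall X Y, metric_val X Y = metric_val Y X;
  metricZD : forall X f Y Z,
    metric_val X (f *: Y + Z) = f * metric_val X Y + metric_val X Z;
  metric_gt0 : forall X p, vf_at X p <> \0 -> 0 < metric_val X X p }.

(* R-linearity in the second argument follows from conn_leibniz, f constant. *)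
Record connection := Connection {
  conn_val :> vfield M -> vfield M -> vfield M;
  connZDl : forall f X Y Z,
    conn_val (f *: X + Y) Z = f *: conn_val X Z + conn_val Y Z;
  connDr : forall X Y Z, conn_val X (Y + Z) = conn_val X Y + conn_val X Z;
  conn_leibniz : forall X f Y,
    conn_val X (f *: Y) = (X f : Cinf M) *: Y + f *: conn_val X Y }.

Definition levi_civita (g : riemannian_metric) (D : connection) : Prop :=
  (forall X Y, D X Y - D Y X = bracket X Y) /\
  (forall X Y Z, X (g Y Z) = g (D X Y) Z + g Y (D X Z)).

Record tensor12 := Tensor12 {
  tensor_val :> vfield M -> vfield M -> vfield M;
  tensorZDl : forall f X Y Z,
    tensor_val (f *: X + Y) Z = f *: tensor_val X Z + tensor_val Y Z;
  tensorZDr : forall X f Y Z,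
    tensor_val X (f *: Y + Z) = f *: tensor_val X Y + tensor_val X Z }.

Section ConnectionDifference.
Variables D1 D2 : connection.

Let B X Y := D1 X Y - D2 X Y.

Lemma conn_diffZDl f X Y Z : B (f *: X + Y) Z = f *: B X Z + B Y Z.
Proof. by rewrite /B !connZDl scalerBr opprD addrACA. Qed.

Lemma conn_diffZDr X f Y Z : B X (f *: Y + Z) = f *: B X Y + B X Z.
Proof.
rewrite /B !connDr !conn_leibniz opprD addrACA; congr (_ + _).
by rewrite opprD addrACA subrr add0r scalerBr.
Qed.

Definition conn_diff : tensor12 := Tensor12 conn_diffZDl conn_diffZDr.

End ConnectionDifference.

Definition weak_frobenius (g : riemannian_metric) (B : tensor12) : Prop :=
  forall X Y Z, g (B X Y) Z = g X (B Y Z).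

End Geometry.

Section LieAlgebra.
Context {R : realType} {m : nat} (G : lieGroupType R m).

(* Here h is f \o (left translation by a), which is always in Cinf G. *)
Definition left_invariant (X : vfield G) : Prop :=
  forall (a : G) (f h : Cinf G), (forall x, h x = f (a * x)%g) ->
  forall x, X h x = X f (a * x)%g.

(* A real number c acts on vector fields as the constant function c *: 1. *)
Definition lie_algebra_basis n (E : 'I_n -> vfield G) : Prop :=
  (forall i, left_invariant (E i)) /\
  (forall X, left_invariant X ->
     exists! c : 'I_n -> R, X = \sum_(i < n) (c i *: (1 : Cinf G)) *: E i).

End LieAlgebra.

(* Main.v *)
From HB Require Import structures.
Require Import Defs.
From mathcomp Require Import all_boot all_order all_algebra.
From mathcomp Require Import boolp classical_sets functions reals.
From mathcomp Require Import ereal topology normedtype landau derive.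
From mathcomp Require Import sequences realfun exp measure lebesgue_measure.
From mathcomp Require Import lebesgue_integral ftc.
From mathcomp Require Import ring lra.

(* All the conditions are C^oo-linear in each vector field, so the point is that
   they may be tested on the basis E, i.e. that E is a frame for vector fields,
   which here are derivations of C^oo(G). Hadamard's lemma and bump functions
   show that a derivation at a point p is a combination of the partial
   derivatives in a chart at p. Taking p = 1 and translating, every derivation
   is at each point a combination of the left-invariant fields that extend the
   partial derivatives at 1, and Cramer's rule makes the coefficients smooth
   after multiplication by a function that does not vanish at the given point.
   With c i j k = g(E i, [E j, E k]), Koszul's formula reads
   2 g(nabla_(E i) (E j), E k) = c k i j - c i j k + c j k i, and each of the six
   identities on the basis is a linear relation between cyclic permutations of
   c that amounts to the cyclic invariance of c. *)

Set Implicit Arguments.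
Unset Strict Implicit.
Unset Printing Implicit Defensive.
Import Order.TTheory GRing.Theory Num.Theory.
Import numFieldNormedType.Exports.
Local Open Scope classical_set_scope.
Local Open Scope ring_scope.

(** * Locality, linear maps and the chain rule for [C^k] functions on open sets *)

Section SmoothCalculus.
Context {R : realType}.

(** Differentiability is a condition at each point, and so is continuity on an open neighbourhood;
    the sets [V] may therefore stick out of [U]. *)
Lemma Ck_on_local m (W : normedModType R) k (U : set 'rV[R]_m)
    (f : 'rV[R]_m -> W) :
  (forall x, U x -> exists V, [/\ open V, V x & Ck_on k V f]) -> Ck_on k U f.
Proof.
elim: k f => [|k IH] f UV /=.
  rewrite continuous_subspace_in => x /set_mem Ux.
  apply: continuous_subspaceT_for => //; have [V [oV Vx]] := UV x Ux.
  by rewrite /= continuous_open_subspace// => /(_ x); apply; rewrite inE.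
split=> [x Ux|v]; first by have [V [_ Vx [/(_ x Vx)]]] := UV x Ux.
by apply: IH => x /UV[V [oV Vx [_ /(_ v)]]]; exists V.
Qed.

Lemma Ck_on_subset m (W : normedModType R) k (U V : set 'rV[R]_m)
    (f : 'rV[R]_m -> W) :
  U `<=` V -> Ck_on k V f -> Ck_on k U f.
Proof.
move=> UV; elim: k f => [|k IH] f /=; first exact: continuous_subspaceW.
by move=> [df dvf]; split=> [x /UV/df|v]; [|exact: IH].
Qed.

(** In finite dimension [f y] is the sum of the [y 0 i *: f 'e_i], and each coordinate is
    continuous. *)
Lemma linear_rV_continuous (W : normedModType R) n
    (f : {linear 'rV[R]_n -> W}) : continuous f.
Proof.
rewrite (_ : (f : _ -> _) = fun y => \sum_i y 0 i *: f 'e_i); last first.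
  apply/funext => y; rewrite [y in LHS]row_sum_delta linear_sum.
  by apply: eq_bigr => i _; rewrite linearZ.
apply: (@continuous_big W _ +%R); first exact: add_continuous.
move=> i _ y; apply: (@cvgZr_tmp _ _ _ (nbhs y) _ (fun y => y 0 i)).
exact: (@coord_continuous _ _ _ 0 i y).
Qed.

Lemma Ck_on_linear m (W : normedModType R) k (U : set 'rV[R]_m)
    (f : {linear 'rV[R]_m -> W}) : Ck_on k U f.
Proof.
have cf := @linear_rV_continuous _ _ f.
case: k => [|k] /=; first exact: continuous_subspaceT.
split=> [x _|v]; first exact: linear_differentiable.
rewrite (_ : 'D_v f = cst (f v)); first exact: Ck_on_cst.
apply/funext => x; rewrite deriveE ?diff_lin//.
exact: linear_differentiable.
Qed.

Lemma Ck_on_coord m n k (U : set 'rV[R]_m) (f : 'rV[R]_m -> 'rV[R]_n) i :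
  open U -> Ck_on k U f -> Ck_on k U (fun y => f y 0 i).
Proof.
move=> oU; elim: k f => [|k IH] f /=.
  rewrite !continuous_open_subspace// => cf x Ux.
  apply: (@continuous_comp _ _ _ f (fun y : 'rV[R]_n => y 0 i)).
    exact: cf.
  exact: coord_continuous.
move=> [df dvf]; split=> [x Ux|v].
  apply: (@differentiable_comp _ _ _ _ f (fun y : 'rV[R]_n => y 0 i)).
    exact: df.
  exact: differentiable_coord.
apply: (@Ck_on_ext _ _ _ _ _ (fun y => 'D_v f y 0 i)) => //; last exact: IH.
by move=> x Ux; rewrite derive_mx ?mxE//; apply: diff_derivable; exact: df.
Qed.

Lemma Ck_on_sum m (W : normedModType R) k (U : set 'rV[R]_m) n
    (f : 'I_n -> 'rV[R]_m -> W) :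
  open U -> (forall i, Ck_on k U (f i)) -> Ck_on k U (\sum_i f i).
Proof.
move=> oU Cf; elim/big_ind: _ => //; first exact: Ck_on_cst.
by move=> *; exact: Ck_onD.
Qed.

Lemma diff_sumE n (f : 'rV[R]_n -> R) y v : differentiable f y ->
  'd f y v = \sum_i v 0 i * 'D_('e_i) f y.
Proof.
move=> df; rewrite [v in LHS]row_sum_delta linear_sum; apply: eq_bigr => i _.
by rewrite linearZ deriveE.
Qed.

Lemma derive_comp_sum m n (u : 'rV[R]_m -> 'rV[R]_n) (f : 'rV[R]_n -> R) x v :
  differentiable u x -> differentiable f (u x) ->
  'D_v (f \o u) x = \sum_i 'D_v u x 0 i * 'D_('e_i) f (u x).
Proof.
move=> du df; rewrite deriveE; last exact: differentiable_comp.
by rewrite diff_comp//= diff_sumE// deriveE.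
Qed.

(** Induction on [k] for all [u] and [f] at once: a directional derivative of [f \o u] is a sum of
    products of derivatives of coordinates of [u] with functions ['D_('e_i) f \o u], to which the
    induction hypothesis applies. *)
Lemma Ck_on_comp m n k (U : set 'rV[R]_m) (V : set 'rV[R]_n)
    (u : 'rV[R]_m -> 'rV[R]_n) (f : 'rV[R]_n -> R) :
  open U -> open V -> (forall x, U x -> V (u x)) ->
  Ck_on k U u -> Ck_on k V f -> Ck_on k U (f \o u).
Proof.
move=> oU oV UV; elim: k u f UV => [|k IH] u f UV.
  rewrite /= !continuous_open_subspace// => cu cf x Ux.
  apply: continuous_comp; first exact: cu.
  by apply: cf; rewrite inE; apply: UV; move: Ux; rewrite inE.
move=> Cu Cf; have uW := Ck_onW oU Cu; case: Cu Cf => du dvu [df dvf].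
split=> [x Ux|v]; first by apply: differentiable_comp; [exact: du|exact/df/UV].
apply: (@Ck_on_ext _ _ _ _ _
  (\sum_i (fun x => 'D_v u x 0 i) * ('D_('e_i) f \o u))) => //.
  move=> x Ux; rewrite derive_comp_sum ?fct_sumE//; [exact: du|exact/df/UV].
apply: Ck_on_sum => // i; apply: Ck_onM => //; first exact/Ck_on_coord/dvu.
by apply: IH => //; exact: dvf.
Qed.

End SmoothCalculus.

(** * The integral over [0, 1] of a continuous function, handled through its primitive *)

Section UnitIntegral.
Context {R : realType}.
Implicit Types h H : R -> R.

Let mu := @lebesgue_measure R.

(* The base point -1 makes this differentiable around both ends of [0, 1]. *)
Definition primitive h (x : R) : R := (\int[mu]_(t in `[-1, x]) h t)%R.

Definition integral01 h : R := primitive h 1 - primitive h 0.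

Lemma primitive_is_derive h (x : R) : continuous h -> -1 < x < 2 ->
  is_derive x 1 (primitive h) (h x).
Proof.
move=> ch /andP[x0 x1].
have int_h : mu.-integrable `[-1, 2] (EFin \o h).
  apply: continuous_compact_integrable; first exact: segment_compact.
  exact: continuous_subspaceT.
have [dp dpE] : derivable (primitive h) x 1 /\ derive1 (primitive h) x = h x.
  exact: (continuous_FTC1_closed x1 int_h x0 (ch x)).
by apply: DeriveDef; [exact: dp|rewrite -derive1E].
Qed.

(** [primitive h - H] has derivative 0 on [0, 1], so its increment vanishes by the mean value
    theorem. Additivity and homogeneity of the integral follow by exhibiting antiderivatives. *)
Lemma integral01E h H : continuous h ->
  (forall s : R, 0 <= s <= 1 -> is_derive s 1 H (h s)) ->
  integral01 h = H 1 - H 0.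
Proof.
move=> ch dH; pose K : R -> R := primitive h - H.
have dK (s : R) : 0 <= s <= 1 -> is_derive s 1 K 0.
  move=> s01; rewrite -(subrr (h s)).
  have dp : is_derive s 1 (primitive h) (h s).
    by apply: primitive_is_derive => //; move: s01; lra.
  have dHs := dH s s01.
  exact: is_deriveB.
have [|||c _] := @MVT_segment R K (fun=> 0) 0 1.
- exact: ler01.
- by move=> x; rewrite in_itv/= => /andP[? ?]; apply: dK; lra.
- apply: derivable_within_continuous => x; rewrite in_itv/= => x01.
  by case: (dK x x01).
- rewrite mul0r /K /integral01 => E.
  have {}E : (primitive h 1 - H 1) - (primitive h 0 - H 0) = 0 := E.
  lra.
Qed.

(** By the mean value theorem for the primitive, the integral is a value [h c] with [c] in
    [0, 1]. *)
Lemma integral01_le h C : continuous h ->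
  (forall s : R, 0 <= s <= 1 -> `|h s| <= C) -> `|integral01 h| <= C.
Proof.
move=> ch hC.
have [|||c] := @MVT_segment R (primitive h) h 0 1.
- exact: ler01.
- move=> x; rewrite in_itv/= => /andP[? ?].
  by apply: primitive_is_derive => //; lra.
- apply: derivable_within_continuous => x; rewrite in_itv/= => x01.
  have dp : is_derive x 1 (primitive h) (h x).
    by apply: primitive_is_derive => //; lra.
  by case: dp.
- by rewrite in_itv/= /integral01 => c01 ->; rewrite subr0 mulr1; exact: hC.
Qed.

Lemma integral01D h1 h2 : continuous h1 -> continuous h2 ->
  integral01 (h1 + h2) = integral01 h1 + integral01 h2.
Proof.
move=> c1 c2.
have c12 : continuous (h1 + h2).
  by move=> x; apply: continuousD; [exact: c1|exact: c2].
pose H : R -> R := primitive h1 + primitive h2.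
have dH (s : R) : 0 <= s <= 1 -> is_derive s 1 H (h1 s + h2 s).
  move=> s01; have d1 : is_derive s 1 (primitive h1) (h1 s).
    by apply: primitive_is_derive => //; lra.
  have d2 : is_derive s 1 (primitive h2) (h2 s).
    by apply: primitive_is_derive => //; lra.
  exact: is_deriveD.
rewrite (integral01E c12 dH) /integral01 /H.
by rewrite [LHS]/(_ + _ - (_ + _)) opprD addrACA.
Qed.

Lemma integral01Z a h : continuous h ->
  integral01 (a *: h) = a * integral01 h.
Proof.
move=> ch.
have cah : continuous (a *: h) by move=> x; apply: continuousZr; exact: ch.
pose H : R -> R := a *: primitive h.
have dH (s : R) : 0 <= s <= 1 -> is_derive s 1 H (a *: h s).
  move=> s01; have dp : is_derive s 1 (primitive h) (h s).
    by apply: primitive_is_derive => //; lra.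
  exact: is_deriveZ.
by rewrite (integral01E cah dH) /integral01 mulrBr.
Qed.

Lemma integral01_sum n (f : 'I_n -> R -> R) : (forall i, continuous (f i)) ->
  integral01 (\sum_i f i) = \sum_i integral01 (f i).
Proof.
move=> cf.
suff [] : continuous (\sum_i f i) /\
  integral01 (\sum_i f i) = \sum_i integral01 (f i) by [].
elim/big_ind2: _ => [|h1 a1 h2 a2 [c1 <-] [c2 <-]|i _].
- split; first by move=> x; exact: cvg_cst.
  have c0 : continuous (0 : R -> R) by move=> x; exact: cvg_cst.
  by have := integral01Z 0 c0; rewrite scale0r mul0r.
- split; last exact: integral01D.
  by move=> x; apply: continuousD; [exact: c1|exact: c2].
- by split=> //; exact: cf.
Qed.

End UnitIntegral.

(** * First-order approximation and differentiability *)

Lemma ler_norm_coord (R : realType) n (v : 'rV[R]_n) i : `|v 0 i| <= `|v|.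
Proof.
rewrite [leRHS]/Num.Def.normr/= mx_normrE.
exact: (@le_bigmax _ _ _ 0 (fun ij => `|v ij.1 ij.2|) (0, i)).
Qed.

Lemma differentiable_of_linear (R : numFieldType) (V W : normedModType R)
    (f : V -> W) (x : V) (df : {linear V -> W}) :
  continuous df ->
  (forall e : R, 0 < e -> \forall v \near (0 : V),
     `|f (v + x) - f x - df v| <= e * `|v|) ->
  differentiable f x /\ 'd f x = df :> (V -> W).
Proof.
move=> cdf fx.
have fE : f \o shift x = cst (f x) + df +o_ (0 : V) id.
  apply/eqaddoP => e e0; near=> v; rewrite /= [X in `|X|](_ : _ =
    f (v + x) - f x - df v); first by near: v; exact: fx.
  by rewrite -addrA -opprD.
have dE := diff_unique cdf fE.
by split=> //; apply/diff_locallyP; rewrite dE; split.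
Unshelve. all: by end_near. Qed.

Lemma differentiable_lin_approx (R : realType) n (f : 'rV[R]_n -> R)
    (x : 'rV[R]_n) (c : 'I_n -> R) :
  (forall e : R, 0 < e -> \forall v \near (0 : 'rV[R]_n),
     `|f (v + x) - f x - \sum_i v 0 i * c i| <= e * `|v|) ->
  differentiable f x /\ forall v, 'D_v f x = \sum_i v 0 i * c i.
Proof.
move=> fx.
have lin : linear (fun v : 'rV[R]_n => \sum_i v 0 i * c i : R^o).
  move=> a u v; rewrite scaler_sumr -big_split/=; apply: eq_bigr => i _.
  by rewrite !mxE mulrDl -mulrA.
pose df : {linear 'rV[R]_n -> R^o} := HB.pack
  (fun v : 'rV[R]_n => \sum_i v 0 i * c i : R^o)
  (GRing.isLinear.Build _ _ _ _ _ lin).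
have cdf := @linear_rV_continuous _ _ _ df.
have [dfx dE] := differentiable_of_linear cdf fx.
by split=> // v; rewrite deriveE// dE.
Qed.

(** * Averages along rays from the origin and their smoothness *)

Section RayAverages.
Context {R : realType} {m : nat}.
Implicit Types (F : 'rV[R]_m -> R) (x v : 'rV[R]_m).

(* The weight s ^ j makes the family stable under differentiation: 'D_v maps
   ray_average j F to ray_average j.+1 ('D_v F). *)
Definition ray_average j F x : R := integral01 (fun s => s ^+ j * F (s *: x)).

Lemma Ck_on0_continuous F : Ck_on 0 setT F -> continuous F.
Proof. by move=> cF; apply/continuous_subspace_setT. Qed.

Lemma ray_continuous j F x : Ck_on 0 setT F ->
  continuous (fun s : R => s ^+ j * F (s *: x)).
Proof.
move=> /Ck_on0_continuous cF s; apply: cvgM; first exact: exprn_continuous.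
by apply: continuous_comp; [exact: scalel_continuous|exact: cF].
Qed.

(** Continuity of [F] at each [s0 *: x] gives the bound for [s] near [s0] and [v] near 0;
    compactness of [0, 1] makes the neighbourhood of [v] independent of [s]. *)
Lemma ray_near_uniform F x (e : R) : Ck_on 0 setT F -> 0 < e ->
  \forall v \near (0 : 'rV[R]_m), forall s t : R, 0 <= s <= 1 -> 0 <= t <= 1 ->
    `|F (s *: x + t *: (s *: v)) - F (s *: x)| <= e.
Proof.
move=> /Ck_on0_continuous cF e0.
pose P (v : 'rV[R]_m) (s : R) := forall t : R, 0 <= t <= 1 ->
  `|F (s *: x + t *: (s *: v)) - F (s *: x)| <= e.
have /compact_near_coveringP/(_ _ (nbhs (0 : 'rV[R]_m)) P) cov :=
  @segment_compact R 0 1.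
suff PF : forall s : R, `[0, 1]%classic s ->
    \forall s' \near s & v \near (0 : 'rV[R]_m), P v s'.
  by apply: filterS (cov _ PF) => v vP s t s01; apply: vP; rewrite /= in_itv.
move=> s0 _.
have [d d0 dF] : exists2 d, 0 < d & forall y, `|y - s0 *: x| < d ->
    `|F y - F (s0 *: x)| <= e / 2.
  have /cvgrPdist_le/(_ (e / 2)) := cF (s0 *: x).
  rewrite divr_gt0// => /(_ isT)/nbhs_ballP[d d0 dF]; exists d => // y yd.
  by rewrite distrC; apply: dF; rewrite -ball_normE/= distrC.
(* [q (s, v)] bounds the distance from [s *: x + t *: (s *: v)] to [s0 *: x] for all [t] in [0, 1],
   and it tends to 0 at [(s0, 0)]. *)
pose q (p : R * 'rV[R]_m) := `|p.1 - s0| * `|x| + `|p.1| * `|p.2|.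
have cq : {for (s0, 0 : 'rV[R]_m), continuous q}.
  apply: (@cvgD _ _ _ _ _ (fun p => `|p.1 - s0| * `|x|)
    (fun p => `|p.1| * `|p.2|)).
    apply: (@cvgM _ _ _ _ (fun p => `|p.1 - s0|) (cst `|x|));
      last exact: cvg_cst.
    apply: (@cvg_norm _ _ _ _ _ (fun p : R * 'rV[R]_m => p.1 - s0)).
    apply: (@cvgB _ _ _ _ _ (fun p : R * 'rV[R]_m => p.1) (cst s0));
      last exact: cvg_cst.
    exact: cvg_fst.
  apply: (@cvgM _ _ _ _ (fun p => `|p.1|) (fun p => `|p.2|)).
    by apply: cvg_norm; exact: cvg_fst.
  by apply: cvg_norm; exact: cvg_snd.
have q0 : q (s0, 0) = 0 by rewrite /q/= subrr !normr0 mul0r mulr0 addr0.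
have : \forall p \near nbhs (s0, 0 : 'rV[R]_m), q p < d.
  by have /cvgr_lt := cq; apply; rewrite q0.
apply: filterS => -[s v]/= qd t t01.
have st : `|s *: x + t *: (s *: v) - s0 *: x| < d.
  apply: le_lt_trans qd; rewrite /q/= addrAC -scalerBl.
  rewrite (le_trans (ler_normD _ _))// !normrZ lerD2l.
  have /andP[t0 t1] := t01; rewrite (ger0_norm t0).
  by rewrite ler_piMl// mulr_ge0.
have s1 : `|s *: x - s0 *: x| < d.
  apply: le_lt_trans qd; rewrite /q/= -scalerBl normrZ lerDl.
  by rewrite mulr_ge0.
have := dF _ st; have := dF _ s1; rewrite distrC => h1 h2.
rewrite -(subrK (F (s0 *: x)) (F (_ + _))) -addrA (le_trans (ler_normD _ _))//.
by rewrite (splitr e) lerD.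
Qed.

Lemma is_derive_line F x v (t : R) : differentiable F (x + t *: v) ->
  is_derive t 1 (fun t : R => F (x + t *: v))
    (\sum_i v 0 i * 'D_('e_i) F (x + t *: v)).
Proof.
move=> dF; pose l (t : R) := x + t *: v.
have dl : is_diff t l (fun h => h *: v).
  have := is_diffD (is_diff_cst x t) (is_diff_scalel t v).
  by rewrite add0r.
have df : differentiable (F \o l) t by exact: differentiable_comp.
apply: DeriveDef; first exact: diff_derivable.
by rewrite deriveE// diff_comp//= diff_val scale1r diff_sumE.
Qed.

(** Differentiation under the integral sign. The error is the integral of a single integrand, which
    the mean value theorem and the uniform continuity of the partial derivatives along the segment
    bound pointwise in [s]. *)
Lemma ray_average_approx j F x : Ck_on 1 setT F -> forall e : R, 0 < e ->
  \forall v \near (0 : 'rV[R]_m),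
    `|ray_average j F (v + x) - ray_average j F x -
      \sum_i v 0 i * ray_average j.+1 ('D_('e_i) F) x| <= e * `|v|.
Proof.
move=> CF e e0; have C0 := Ck_onW openT CF; case: CF => dF dvF.
(* Each of the [m] partial derivatives contributes at most [d * |v|]; dividing by [m.+1] also covers
   [m = 0]. *)
pose d := e / m.+1%:R; have d0 : 0 < d by rewrite divr_gt0.
have unif : \forall v \near (0 : 'rV[R]_m), forall i (s t : R),
    0 <= s <= 1 -> 0 <= t <= 1 ->
    `|'D_('e_i) F (s *: x + t *: (s *: v)) - 'D_('e_i) F (s *: x)| <= d.
  apply: (@filter_forall _ 'I_m (fun i v => forall s t : R,
    0 <= s <= 1 -> 0 <= t <= 1 ->
    `|'D_('e_i) F (s *: x + t *: (s *: v)) - 'D_('e_i) F (s *: x)| <= d)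
    (nbhs (0 : 'rV[R]_m)) (nbhs_filter (0 : 'rV[R]_m))) => i.
  exact: (ray_near_uniform x (dvF _) d0).
apply: filterS unif => v unif.
pose h1 (s : R) := s ^+ j * F (s *: (v + x)).
pose h2 (s : R) := s ^+ j * F (s *: x).
pose g i (s : R) := s ^+ j.+1 * 'D_('e_i) F (s *: x).
have ch1 : continuous h1 by exact: ray_continuous.
have ch2 : continuous h2 by exact: ray_continuous.
have cg i : continuous (g i) by exact: (ray_continuous (dvF _)).
have cZ (a : R) (h : R -> R) : continuous h -> continuous (a *: h).
  by move=> ch s; apply: continuousZr; exact: ch.
have cS : continuous (\sum_i (- v 0 i) *: g i).
  elim/big_ind: _ => [s|h h' ch ch' s|i _]; last exact: cZ.
    exact: cvg_cst.
  by apply: continuousD; [exact: ch|exact: ch'].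
have c12 : continuous (h1 + (-1) *: h2).
  by move=> s; apply: continuousD; [exact: ch1|exact: cZ].
have -> : ray_average j F (v + x) - ray_average j F x -
      \sum_i v 0 i * ray_average j.+1 ('D_('e_i) F) x =
    integral01 (h1 + (-1) *: h2 + \sum_i (- v 0 i) *: g i).
  rewrite (integral01D c12 cS) (integral01D ch1 (cZ _ _ ch2)) integral01Z//.
  rewrite mulN1r integral01_sum//; last by move=> i; exact: cZ.
  congr (_ + _); rewrite -sumrN; apply: eq_bigr => i _.
  by rewrite integral01Z// mulNr.
apply: integral01_le => [|s s01].
  by move=> s; apply: continuousD; [exact: c12|exact: cS].
(* The intermediate point [t] depends on [s] with no known regularity, which is harmless because
   [unif] holds for all [t]. The increment [s *: v] supplies the extra factor [s] that raises the
   weight to [j.+1]. *)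
have [|||t] := @MVT_segment R (fun t => F (s *: x + t *: (s *: v)))
  (fun t => \sum_i (s *: v) 0 i * 'D_('e_i) F (s *: x + t *: (s *: v))) 0 1.
- exact: ler01.
- by move=> t _; apply: is_derive_line; exact: dF.
- apply: derivable_within_continuous => t _.
  by case: (is_derive_line (dF (s *: x + t *: (s *: v)) I)).
rewrite in_itv/= => t01; rewrite scale0r addr0 scale1r subr0 mulr1 => FE.
have -> : (h1 + (-1) *: h2 + \sum_i (- v 0 i) *: g i) s = s ^+ j.+1 *
    \sum_i v 0 i * ('D_('e_i) F (s *: x + t *: (s *: v)) -
      'D_('e_i) F (s *: x)).
  have -> : (h1 + (-1) *: h2 + \sum_i (- v 0 i) *: g i) s =
      h1 s + (-1) * h2 s + (\sum_i (- v 0 i) *: g i) s by [].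
  rewrite fct_sumE /h1 /h2 mulN1r scalerDr [s *: v + _]addrC -mulrBr FE.
  rewrite !mulr_sumr -big_split/=; apply: eq_bigr => i _.
  have -> : ((- v 0 i) *: g i) s = - v 0 i * g i s by [].
  by rewrite mxE /g exprSr; ring.
have /andP[s0 s1] := s01.
rewrite normrM normrX (ger0_norm s0) (@le_trans _ _ (\sum_(i < m) `|v| * d))//.
  rewrite -[leRHS]mul1r ler_pM// ?exprn_ge0// ?exprn_ile1//.
  rewrite (le_trans (ler_norm_sum _ _ _))//; apply: ler_sum => i _.
  by rewrite normrM ler_pM//; [exact: ler_norm_coord|exact: unif].
rewrite sumr_const card_ord -mulr_natl mulrCA mulrC ler_wpM2r//.
rewrite /d mulrCA ler_piMr ?(ltW e0)// ler_pdivrMr// mul1r.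
by rewrite ler_nat.
Qed.

Lemma ray_average_diff j F x : Ck_on 1 setT F ->
  differentiable (ray_average j F) x /\
  forall v, 'D_v (ray_average j F) x =
    \sum_i v 0 i * ray_average j.+1 ('D_('e_i) F) x.
Proof.
by move=> CF; apply: differentiable_lin_approx; exact: ray_average_approx.
Qed.

(** Derivatives of the average are combinations of averages of weight [j.+1] of the partial
    derivatives of [F], so the induction on [k] runs over all [j] and [F]. *)
Lemma ray_average_Ck j k F : smooth_on setT F -> Ck_on k setT (ray_average j F).
Proof.
elim: k j F => [|k IH] j F sF.
  apply: continuous_subspaceT => x.
  by apply: differentiable_continuous; have [] := ray_average_diff j x (sF 1%N).
split=> [x _|v]; first by have [] := ray_average_diff j x (sF 1%N).
rewrite (_ : 'D_v _ =
    \sum_i v 0 i *: (ray_average j.+1 ('D_('e_i) F) : _ -> R^o)).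
  apply: Ck_on_sum => [|i]; first exact: openT.
  apply: Ck_onZ; first exact: openT.
  by apply: IH => l; have [_] := sF l.+1; exact.
apply/funext => x; rewrite (ray_average_diff j x (sF 1%N)).2 fct_sumE.
by [].
Qed.

(** [F x - F 0] is the integral over [0, 1] of the derivative of [s |-> F (s *: x)]. *)
Lemma hadamard0 F : smooth_on setT F -> F 0 = 0 ->
  forall x, F x = \sum_i x 0 i * ray_average 0 ('D_('e_i) F) x.
Proof.
move=> sF F0 x; have [dF dvF] := sF 1%N.
have cg i : continuous (fun s : R => s ^+ 0 * 'D_('e_i) F (s *: x)).
  exact: (@ray_continuous 0 _ x (dvF _)).
pose g : R -> R := \sum_i x 0 i *: (fun s : R => s ^+ 0 * 'D_('e_i) F (s *: x)).
have cxg i : continuous (x 0 i *: (fun s : R => s ^+ 0 * 'D_('e_i) F (s *: x))).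
  by move=> s; apply: continuousZr; exact: cg.
have cG : continuous g.
  rewrite /g; elim/big_ind: _ => [s|h h' ch ch' s|i _]; last exact: cxg.
    exact: cvg_cst.
  by apply: continuousD; [exact: ch|exact: ch'].
have dl (s : R) : 0 <= s <= 1 -> is_derive s 1 (fun t => F (0 + t *: x)) (g s).
  move=> _; rewrite (_ : g s = \sum_i x 0 i * 'D_('e_i) F (0 + s *: x)).
    by apply: is_derive_line; exact: dF.
  rewrite /g fct_sumE; apply: eq_bigr => i _.
  by rewrite add0r; congr (_ * _); exact: mul1r.
have := integral01E cG dl; rewrite !add0r scale1r scale0r F0 subr0 => <-.
rewrite /g integral01_sum//; apply: eq_bigr => i _.
by rewrite integral01Z.
Qed.

End RayAverages.

(** * Hadamard's lemma at an arbitrary point *)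

Section Hadamard.
Context {R : realType} {m : nat}.
Implicit Types (F : 'rV[R]_m -> R) (p x v : 'rV[R]_m).

Lemma Ck_on_shift k (U : set 'rV[R]_m) p : open U ->
  Ck_on k U (fun x : 'rV[R]_m => x + p).
Proof.
move=> oU; apply: (@Ck_onD _ _ _ _ _ idfun (cst p)) => //;
  last exact: Ck_on_cst.
exact: (Ck_on_linear k U idfun).
Qed.

Lemma derive_shift_comp F p v x : 'D_v (fun y => F (y + p)) x = 'D_v F (x + p).
Proof. by rewrite /derive; under [in RHS]eq_fun do rewrite /= addrA. Qed.

Lemma integral01_cst (c : R) : integral01 (cst c) = c.
Proof.
have dH (s : R) : 0 <= s <= 1 -> is_derive s 1 (fun t => t *: (c : R^o)) c.
  move=> _; have ds := is_diff_scalel s (c : R^o).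
  apply: DeriveDef; first by apply: diff_derivable.
  by rewrite deriveE// diff_val scale1r.
have cc : continuous (cst c : R -> R) by move=> s; exact: cvg_cst.
by rewrite (integral01E cc dH) scale1r scale0r subr0.
Qed.

(** Apply the case of the origin to [F (x + p) - F p]. At [p] the ray is constant, so the average
    there is the partial derivative itself. *)
Lemma hadamard F p : smooth_on setT F ->
  exists G : 'I_m -> 'rV[R]_m -> R, [/\ forall i, smooth_on setT (G i),
    forall i, G i p = 'D_('e_i) F p &
    forall x, F x = F p + \sum_i (x - p) 0 i * G i x].
Proof.
move=> sF; pose F' x := F (x + p) - F p.
have sF' : smooth_on setT F'.
  move=> k; apply: (@Ck_onD _ _ _ _ _ (fun x => F (x + p)) (cst (- F p))).
  - exact: openT.
  - apply: (@Ck_on_comp _ _ _ _ _ setT (fun x => x + p) F) => //;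
    try exact: openT.
    by apply: Ck_on_shift; exact: openT.
  - exact: Ck_on_cst.
pose G0 i := ray_average 0 ('D_('e_i) F').
exists (fun i x => G0 i (x - p)); split=> [i k|i|x].
- apply: (@Ck_on_comp _ _ _ _ _ setT (fun x => x + - p) (G0 i)) => //;
  try exact: openT.
    by apply: Ck_on_shift; exact: openT.
  apply: ray_average_Ck => l; have [_] := sF' l.+1; exact.
- rewrite subrr /G0 /ray_average.
  have -> : (fun s : R => s ^+ 0 * 'D_('e_i) F' (s *: 0)) =
    cst ('D_('e_i) F' 0).
    by apply/funext => s; rewrite scaler0 expr0 mul1r.
  rewrite integral01_cst -[in RHS](add0r p) -derive_shift_comp.
  have dF x : derivable (fun y => F (y + p)) x ('e_i).
    have sFp : Ck_on 1 setT (fun y => F (y + p)).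
      apply: (@Ck_on_comp _ _ _ _ _ setT (fun x => x + p) F) => //;
        try exact: openT.
      by apply: Ck_on_shift; exact: openT.
    by apply: diff_derivable; case: sFp => + _; exact.
  by rewrite deriveB// derive_cst subr0.
- have := hadamard0 sF' _ (x - p); rewrite /F' add0r subrr => /(_ erefl).
  by rewrite subrK => /eqP; rewrite subr_eq addrC => /eqP.
Qed.

End Hadamard.

(** * Flat functions and smooth bump functions *)

Section Bump.
Context {R : realType}.

(* Closed under differentiation up to linear combinations, which makes each
   [flat k] infinitely differentiable. *)
Definition flat k (t : R) : R := if 0 < t then t ^- k * expR (- t^-1) else 0.

(** The term of degree [k.+1] of the exponential series bounds [expR t^-1] from below. *)
Lemma flat_le k (t : R) : 0 < t -> flat k t <= k.+1`!%:R * t.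
Proof.
move=> t0; rewrite /flat t0 expRN.
have := @expR_ge1Dxn R t^-1 k; rewrite invr_ge0 (ltW t0) => /(_ isT) h.
have {}h : t^-1 ^+ k.+1 / k.+1`!%:R <= expR t^-1 by lra.
rewrite ler_pdivrMr ?expR_gt0// -exprVn.
move: h; rewrite ler_pdivrMr ?ltr0n ?fact_gt0// exprSr => h.
rewrite -(@ler_pM2r _ t^-1) ?invr_gt0// [leRHS]mulrAC mulfK ?gt_eqF//.
by rewrite [leRHS]mulrC.
Qed.

(** Away from 0 this is the product rule or the derivative of the zero function; only [t = 0] needs
    a limit. *)
Lemma flat_derive k (t : R) :
  is_derive t 1 (flat k) (- k%:R * flat k.+1 t + flat k.+2 t).
Proof.
have [t0|t0|<-] := ltgtP 0 t.
- apply: (@near_eq_is_derive _ _ _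
      (((fun s : R => s^-1) ^+ k) * (expR \o (fun s : R => - s^-1)))).
    near=> s; rewrite /flat ifT; last by near: s; exact: lt_nbhsr.
    by rewrite -exprVn exprfctE.
  have tn0 : t != 0 by rewrite gt_eqF.
  have di : is_derive t 1 (fun s : R => s^-1) (- t ^- 2 *: 1).
    exact: (is_deriveV tn0 (is_derive_id t 1)).
  have dN : is_derive t 1 (fun s : R => - s^-1) (- (- t ^- 2 *: 1)).
    exact: is_deriveN.
  have de : is_derive t 1 (expR \o (fun s : R => - s^-1))
      (expR (- t^-1) * - (- t ^- 2 *: 1)).
    exact: (@is_derive1_comp _ expR (fun s : R => - s^-1) t _ _
      (is_derive_expR (- t^-1)) dN).
  have dX : is_derive t 1 ((fun s : R => s^-1) ^+ k)
      ((k%:R * t^-1 ^+ k.-1) *: (- t ^- 2 *: 1)).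
    exact: is_deriveX.
  apply: (is_derive_eq (is_deriveM dX de)).
  rewrite /flat t0.
  have -> : ((fun s : R => s^-1) ^+ k) t = t^-1 ^+ k by rewrite exprfctE.
  have -> : (expR \o (fun s : R => - s^-1)) t = expR (- t^-1) by [].
  rewrite -!exprVn; move: (expR _) => e.
  transitivity (t^-1 ^+ k * (e * - (- t^-1 ^+ 2 * 1)) +
    e * ((k%:R * t^-1 ^+ k.-1) * (- t^-1 ^+ 2 * 1))); first by [].
  case: k {dX} => [|k] /=; first by ring.
  by rewrite !exprS; ring.
- apply: (@near_eq_is_derive _ _ _ (cst 0)).
    near=> s; rewrite /flat ifF//; apply/negbTE; rewrite -leNgt ltW//.
    by near: s; exact: lt_nbhsl.
  apply: is_derive_eq.
  by rewrite /flat !ifF ?mulr0 ?addr0//; apply/negbTE; rewrite -leNgt ltW.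
- have E : - k%:R * flat k.+1 0 + flat k.+2 0 = 0.
    by rewrite /flat ltxx mulr0 addr0.
  (* At 0 the difference quotient is 0 for [h < 0] and [flat k.+1 h] for [h > 0], which [flat_le]
     bounds by a multiple of [h]. *)
  have q0 : (fun h : R => h^-1 *: ((flat k \o shift 0) (h *: 1) - flat k 0))
      @ 0^' --> (0 : R).
    apply/cvgrPdist_le => e e0; near=> h.
    rewrite sub0r normrN /= addr0 [h *: 1]mulr1.
    rewrite [X in _ - X]/flat ltxx subr0.
    have [h0|h0] := ltP 0 h; last first.
      by rewrite /flat ltNge h0 scaler0 normr0 ltW.
    have -> : h^-1 *: flat k h = flat k.+1 h.
      by rewrite /flat h0 exprS invfM -mulrA.
    rewrite ger0_norm; last first.
      by rewrite /flat h0 mulr_ge0 ?invr_ge0 ?exprn_ge0 ?expR_ge0 ?(ltW h0).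
    apply: (le_trans (flat_le _ h0)).
    rewrite mulrC -ler_pdivlMr ?ltr0n ?fact_gt0// -(ger0_norm (ltW h0)).
    near: h; apply: dnbhs0_le.
    by rewrite divr_gt0// ltr0n fact_gt0.
  rewrite E; apply: DeriveDef; first by apply/cvg_ex; exists 0.
  exact: cvg_lim q0.
Unshelve. all: by end_near. Qed.

Lemma Ck_on_flat m k n (q : 'rV[R]_m -> R) : smooth_on setT q ->
  Ck_on n setT (flat k \o q).
Proof.
move=> sq; have dflat j (t : R) : differentiable (flat j) t.
  by apply/derivable1_diffP; case: (flat_derive j t).
have dq x : differentiable q x by have [+ _] := sq 1%N; exact.
have dc j x : differentiable (flat j \o q) x by exact: differentiable_comp.
elim: n k => [|n IH] k.
  by apply: continuous_subspaceT => x; exact: differentiable_continuous.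
split=> // v; have [_ /(_ v) dvq] := sq n.+1.
have o := @openT 'rV[R]_m.
apply: (@Ck_on_ext _ _ _ _ _
  ((- k%:R *: (flat k.+1 \o q) + (flat k.+2 \o q)) * 'D_v q)) => //.
  move=> x _; rewrite deriveE// diff_comp//= -(deriveE _ (dq x)) diff1E//=.
  rewrite derive1E (@derive_val _ _ _ _ _ _ _ (flat_derive k (q x))).
  by rewrite [RHS]mulrC.
by apply: Ck_onM => //; apply: Ck_onD => //; apply: Ck_onZ.
Qed.

(** Compose [flat 0] with [r ^+ 2] minus the squared Euclidean distance to [p]. That distance is
    squared to be polynomial, and its ball of radius [r] lies in the ball of the same radius for the
    sup norm of row vectors. *)
Lemma bump_exists m (p : 'rV[R]_m) (r : R) : 0 < r ->
  exists b : 'rV[R]_m -> R, [/\ smooth_on setT b, b p != 0 &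
    forall x, b x != 0 -> `|x - p| < r].
Proof.
move=> r0; have o := @openT 'rV[R]_m.
pose q x : R := r ^+ 2 - \sum_i (x - p) 0 i ^+ 2.
have sq : smooth_on setT q.
  move=> k; apply: (@Ck_on_ext _ _ _ _ _ (cst (r ^+ 2) + \sum_i (-1) *:
    ((fun x : 'rV[R]_m => (x - p) 0 i) * (fun x : 'rV[R]_m =>
      (x - p) 0 i)))) => //.
    move=> x _; rewrite /q -sumrN [LHS]/(_ + _ x) fct_sumE; congr (_ + _).
    by apply: eq_bigr => i _; exact: mulN1r.
  apply: Ck_onD => //; first exact: Ck_on_cst.
  apply: Ck_on_sum => // i; apply: Ck_onZ => //.
  have Ci : Ck_on k setT (fun x : 'rV[R]_m => (x - p) 0 i).
    by apply: Ck_on_coord => //; exact: Ck_on_shift.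
  exact: Ck_onM.
exists (flat 0 \o q); split=> [n||x].
- exact: Ck_on_flat.
- rewrite /= /q subrr big1 ?subr0 => [|i _]; last by rewrite mxE expr0n.
  by rewrite /flat exprn_gt0// mulf_neq0 ?invr_neq0 ?gt_eqF ?expR_gt0.
- rewrite /= /flat; case: ifPn => [q0 _|]; last by rewrite eqxx.
  rewrite [ltLHS]/Num.Def.normr/= mx_normrE;
    apply: bigmax_lt => //= -[i j] _ /=.
  rewrite ord1 -(@ltr_pXn2r _ 2) ?nnegrE ?(ltW r0)// real_normK ?num_real//.
  move: q0; rewrite /q subr_gt0; apply: le_lt_trans.
  rewrite (bigD1 j)//= lerDl; apply: sumr_ge0 => l _; exact: sqr_ge0.
Qed.

End Bump.

(** * Charts of a manifold *)

Section ChartFacts.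
Context {R : realType} {m : nat} (M : manifoldType R m).
Implicit Types (c d : chart R m M) (O : set M).

Lemma atlas_chart c : atlas c -> is_chart c.
Proof. by case: (@atlasP R m M) => cA _ _ /cA. Qed.

Lemma chart_mapK c x : atlas c -> chart_dom c x ->
  chart_inv c (chart_map c x) = x.
Proof. by move=> /atlas_chart[_ _ cK _ _] /cK. Qed.

Lemma chart_im_map c x : chart_dom c x -> chart_im c (chart_map c x).
Proof. by move=> cx; exists x. Qed.

Lemma chart_dom_inv c y : atlas c -> chart_im c y ->
  chart_dom c (chart_inv c y).
Proof. by move=> Ac [x cx <-]; rewrite chart_mapK. Qed.

Lemma chart_invK c y : atlas c -> chart_im c y ->
  chart_map c (chart_inv c y) = y.
Proof. by move=> Ac [x cx <-]; rewrite chart_mapK. Qed.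

Lemma open_chart_dom c : atlas c -> open (chart_dom c).
Proof. by case/atlas_chart. Qed.

Lemma chart_inv_preimage c O : atlas c ->
  chart_map c @` (chart_dom c `&` O) = chart_im c `&` chart_inv c @^-1` O.
Proof.
move=> Ac; apply/seteqP; split=> [y [x [cx Ox] <-]|y [[x cx <-]]].
  by split; [exists x|rewrite /= chart_mapK].
by rewrite /= chart_mapK// => Ox; exists x.
Qed.

Lemma chart_open_image c O : atlas c -> open O ->
  open (chart_map c @` (chart_dom c `&` O)).
Proof.
move=> Ac oO; rewrite chart_inv_preimage//.
have oc := chart_im_open Ac.
have [_ _ _ _ cinv] := atlas_chart Ac.
by rewrite continuous_open_subspace// in cinv; exact: (continuous_inP _ oc).1.
Qed.

Lemma atlas_cover (x : M) : exists2 c, atlas c & chart_dom c x.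
Proof. by case: (@atlasP R m M) => _ + _; exact. Qed.

Lemma atlas_compatible c d : atlas c -> atlas d -> compatible_charts c d.
Proof. by case: (@atlasP R m M) => _ _; exact. Qed.

End ChartFacts.

Lemma smooth_on_extend0 (R : realType) m (U K : set 'rV[R]_m)
    (w : 'rV[R]_m -> R) :
  open U -> closed K -> K `<=` U -> smooth_on U w ->
  (forall y, w y != 0 -> K y) -> smooth_on setT w.
Proof.
move=> oU cK KU sw wK k; apply: Ck_on_local => y _.
have [Ky|nKy] := pselect (K y); first by exists U; split=> //; exact: KU.
exists (~` K); split=> //; first exact: closed_openC.
apply: (@Ck_on_ext _ _ _ _ _ (cst 0)); last exact: Ck_on_cst.
  exact: closed_openC.
move=> x nKx; apply/esym/eqP/negPn/negP => /wK; exact: nKx.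
Qed.

(** * Extension by zero of functions supported in a chart *)

Section Extension.
Context {R : realType} {m : nat} (M : manifoldType R m).
Implicit Types (c d : chart R m M) (w : 'rV[R]_m -> R).

Definition chart_extend c w (x : M) : R :=
  if `[< chart_dom c x >] then w (chart_map c x) else 0.

Lemma chart_extend_in c w x : chart_dom c x ->
  chart_extend c w x = w (chart_map c x).
Proof. by move=> cx; rewrite /chart_extend asboolT. Qed.

Lemma chart_extend_out c w x : ~ chart_dom c x -> chart_extend c w x = 0.
Proof. by move=> cx; rewrite /chart_extend asboolF. Qed.

(** Inside the domain of [c] the transition maps give smoothness. Elsewhere the extension vanishes
    on the complement of the image of [K], which is open because a compact subset of a Hausdorff
    space is closed. *)
Lemma chart_extend_smooth c (K : set 'rV[R]_m) w : atlas c ->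
  compact K -> K `<=` chart_im c -> smooth_on (chart_im c) w ->
  (forall y, w y != 0 -> K y) -> smooth_fun (chart_extend c w).
Proof.
move=> Ac coK Kc sw wK d Ad k; apply: Ck_on_local => y dy.
have [cx|ncx] := pselect (chart_dom c (chart_inv d y)).
  exists (chart_map d @` (chart_dom d `&` chart_dom c)).
  have oV := chart_open_image Ad (open_chart_dom Ac); split=> //.
    by rewrite chart_inv_preimage.
  apply: (@Ck_on_ext _ _ _ _ _ (w \o (chart_map c \o chart_inv d))) => //.
    move=> z; rewrite chart_inv_preimage// => -[_ cz].
    by rewrite /= chart_extend_in.
  apply: (Ck_on_comp oV (chart_im_open Ac)) => //; last exact: atlas_compatible.
  by move=> z; rewrite chart_inv_preimage// => -[_ cz]; exact: chart_im_map.
have cK' : closed (chart_inv c @` K).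
  apply: compact_closed; first exact: manifold_hausdorff.
  apply: continuous_compact => //.
  have [_ _ _ _] := atlas_chart Ac; exact: continuous_subspaceW.
have oV := chart_open_image Ad (closed_openC cK').
exists (chart_map d @` (chart_dom d `&` ~` (chart_inv c @` K))); split=> //.
  rewrite chart_inv_preimage//; split=> //= -[z Kz zy]; apply: ncx.
  by rewrite -zy; apply: chart_dom_inv => //; exact: Kc.
apply: (@Ck_on_ext _ _ _ _ _ (cst 0)) => //; last exact: Ck_on_cst.
move=> z; rewrite chart_inv_preimage// => -[_ nKz] /=.
have [cz|] := pselect (chart_dom c (chart_inv d z)); last first.
  by move=> ncz; rewrite chart_extend_out.
rewrite chart_extend_in//; apply/esym/eqP/negPn/negP => /wK Kz; apply: nKz.
by exists (chart_map c (chart_inv d z)) => //; rewrite chart_mapK.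
Qed.

End Extension.

Lemma derive_coord (R : realType) m (p x v : 'rV[R]_m) i :
  'D_v (fun y => (y - p) 0 i) x = v 0 i.
Proof.
rewrite (derive_shift_comp (fun y => y 0 i)).
have lin : linear (fun y : 'rV[R]_m => y 0 i : R^o).
  by move=> a y z; rewrite !mxE.
pose f : {linear 'rV[R]_m -> R^o} := HB.pack (fun y : 'rV[R]_m => y 0 i : R^o)
  (GRing.isLinear.Build _ _ _ _ _ lin).
have df y : differentiable f y.
  by apply: linear_differentiable; exact: linear_rV_continuous.
have := deriveE v (df (x - p)); rewrite diff_lin//.
exact: linear_rV_continuous.
Qed.

(** * Derivations at a point in terms of partial derivatives *)

Section PointDerivation.
Context {R : realType} {m : nat} (M : manifoldType R m).
Local Notation C := (Cinf M).
Implicit Types (f h : C) (p : M).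

Definition point_derivation p (v : C -> R) : Prop :=
  [/\ forall f h, v (f + h) = v f + v h,
      forall (a : R) f, v (a *: f) = a * v f &
      forall f h, v (f * h) = v f * h p + f p * v h].

Lemma CinfME f h x : (f * h) x = f x * h x.
Proof. by []. Qed.

Lemma Cinf_sumE n (F : 'I_n -> C) x : (\sum_i F i) x = \sum_i F i x.
Proof. by elim/big_ind2: _ => // f1 u1 f2 u2 <- <-. Qed.

Lemma Cinf_smooth f : smooth_fun f.
Proof. by apply/smooth_predP; exact: Cinf_valP. Qed.

Lemma smooth_CinfP (f : M -> R) : smooth_fun f ->
  exists F : C, forall x, F x = f x.
Proof. by move=> /smooth_predP sf; exists (MkCinf sf). Qed.

(* For a bump [b] at [p] supported in the chart, Hadamard's lemma for
   [b * (f - f p)] gives [b^3 (f - f p) = \sum_i (b u_i) (b G_i)], where [u_i]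
   are the centred coordinates and every factor on the right is a global
   function; no plateau of [b] is needed. *)
Lemma point_derivation_coordinates (c : chart R m M) p :
  atlas c -> chart_dom c p ->
  exists x : 'I_m -> C,
    (forall i j, 'D_('e_j) (x i \o chart_inv c) (chart_map c p) =
      (i == j)%:R) /\
    forall v f, point_derivation p v ->
      v f = \sum_i v (x i) * 'D_('e_i) (f \o chart_inv c) (chart_map c p).
Proof.
move=> Ac cp; pose y0 := chart_map c p; have oc := chart_im_open Ac.
have oT := @openT 'rV[R]_m.
have y0c : chart_im c y0 by exact: chart_im_map.
have [r r0 rc] : exists2 r : R, 0 < r & ball y0 r `<=` chart_im c.
  have /nbhs_ballP[r r0 rc] : nbhs y0 (chart_im c) by exact: open_nbhs_nbhs.
  by exists r.
(* Half the radius keeps the closed ball [K] inside the chart image. *)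
have r20 : 0 < r / 2 by rewrite divr_gt0.
have [b [sb b0 bK]] := bump_exists y0 r20.
pose K := closed_ball y0 (r / 2).
have Kc : K `<=` chart_im c.
  apply: subset_trans rc; apply: closed_ball_subset => //.
  by rewrite ltr_pdivrMr// mulr_natr mulr2n ltrDl.
have clK : closed K by exact: closed_ball_closed.
have coK : compact K.
  apply: bounded_closed_compact => //; rewrite /K closed_ballE//.
  exists (`|y0| + r / 2); split=> [|N yN y /= yr]; first exact: num_real.
  rewrite (le_trans _ (ltW yN))// -[y](subKr y0) (le_trans (ler_normB _ _))//.
  by rewrite lerD2l.
have {}bK y : b y != 0 -> K y.
  move=> /bK /ltW by_; rewrite /K closed_ballE//= /closed_ball_ /=.
  by rewrite distrC.
have ext (u : 'rV[R]_m -> R) : smooth_on (chart_im c) u ->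
    exists X : C, (forall x, chart_dom c x ->
      X x = b (chart_map c x) * u (chart_map c x))
      /\ (forall x, ~ chart_dom c x -> X x = 0).
  move=> su; have : smooth_fun (chart_extend c (b * u)).
    apply: (chart_extend_smooth Ac coK) => //.
      by move=> k; apply: Ck_onM => //; exact: Ck_on_subset (sb k).
    move=> y; have -> : (b * u) y = b y * u y by [].
    by rewrite mulf_eq0 negb_or => /andP[/bK].
  move=> /smooth_CinfP[X XE]; exists X; split=> x cx; rewrite XE.
    exact: chart_extend_in.
  exact: chart_extend_out.
have s1 : smooth_on (chart_im c) (cst 1 : _ -> R) by move=> k; exact: Ck_on_cst.
have [B [Bin Bout]] := ext _ s1.
pose u i (y : 'rV[R]_m) : R := (y - y0) 0 i.
have su i : smooth_on (chart_im c) (u i).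
  by move=> k; apply: Ck_on_coord => //; exact: Ck_on_shift.
have /choice[X0 X0E] := fun i => ext _ (su i).
(* [X0 i] is [b * u i] extended by zero. Since [u i] vanishes at [y0], its derivative there is
   [b y0] times that of [u i]; hence the normalisation. *)
pose x i : C := (b y0)^-1 *: X0 i.
have db : differentiable b y0 by case: (sb 1%N) => + _; exact.
have dc (h : 'rV[R]_m -> R) : smooth_on (chart_im c) h -> differentiable h y0.
  by move=> sh; case: (sh 1%N) => + _; exact.
exists x; split=> [i j|v f [vD vZ vM]].
  rewrite (@near_eq_derive _ _ _ _ ((b y0)^-1 *: (b * u i))); last first.
    apply: (near_open oc y0c) => y cy /=.
    rewrite [LHS]/((b y0)^-1 * X0 i _) (X0E i).1; last exact: chart_dom_inv.
    by rewrite chart_invK.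
  have du := @diff_derivable _ _ _ _ _ 'e_j (dc _ (su i)).
  have dbj := @diff_derivable _ _ _ _ _ 'e_j db.
  have -> := deriveZ (b y0)^-1 (derivableM dbj du).
  have -> := deriveM dbj du.
  have -> : u i y0 = 0 by rewrite /u subrr mxE.
  have -> : 'D_('e_j) (u i) y0 = (i == j)%:R.
    by rewrite /u derive_coord mxE eqxx.
  by rewrite scale0r addr0; exact: mulKf.
pose F y := b y * (f (chart_inv c y) - f p).
have sF : smooth_on setT F.
  apply: (smooth_on_extend0 oc clK Kc).
    move=> k; apply: (@Ck_onM _ _ _ _ b (fun y =>
      f (chart_inv c y) - f p)) => //.
      exact: Ck_on_subset (sb k).
    apply: (@Ck_onD _ _ _ _ _ (f \o chart_inv c) (cst (- f p))) => //.
      exact: Cinf_smooth.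
    exact: Ck_on_cst.
  by move=> y; rewrite mulf_eq0 negb_or => /andP[/bK].
have [G [sG Gy0 FE]] := hadamard y0 sF.
have sGc i : smooth_on (chart_im c) (G i).
  by move=> k; apply: Ck_on_subset (sG i k).
have /choice[Y YE] := fun i => ext _ (sGc i).
have key : B * B * B * (f - f p *: (1 : C)) = \sum_i X0 i * Y i.
  apply: val_inj; apply/funext => z.
  rewrite [RHS]Cinf_sumE; transitivity (B z * B z * B z * (f z - f p)).
    by congr (_ * (_ - _)); exact: mulr1.
  have [cz|ncz] := pselect (chart_dom c z); last first.
    rewrite Bout// !mul0r big1// => i _.
    by rewrite CinfME (X0E i).2// mul0r.
  rewrite Bin// mulr1.
  have F0 : F y0 = 0 by rewrite /F /y0 chart_mapK// subrr mulr0.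
  have := FE (chart_map c z); rewrite F0 add0r {1}/F chart_mapK// => FEz.
  rewrite -!mulrA FEz !mulr_sumr; apply: eq_bigr => i _.
  rewrite [RHS]CinfME (X0E i).1// (YE i).1// /u; ring.
have v1 : v 1 = 0.
  have := vM 1 1; rewrite mulr1 mul1r; have -> : (1 : C) p = 1 by [].
  by rewrite mulr1 => /eqP;
    rewrite -subr_eq0 opprD addrA subrr sub0r oppr_eq0 => /eqP.
have v0 : v 0 = 0 by rewrite -(scale0r (0 : C)) vZ mul0r.
have vsum (g : 'I_m -> C) : v (\sum_i g i) = \sum_i v (g i).
  by elim/big_ind2: _ => // h1 a1 h2 a2 <- <-.
(* In the Leibniz rule, [f - f p] and each [X0 i] vanish at [p]: the left side becomes
   [b y0 ^+ 3 * v f], the right side the sum of [v (X0 i) * Y i p], where [Y i p] is [b y0 ^+ 2]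
   times a partial derivative of [f]. *)
have := congr1 v key; rewrite vM vsum.
have -> : v (f - f p *: (1 : C)) = v f.
  by rewrite -scaleNr vD vZ v1 mulr0 addr0.
have -> : (f - f p *: (1 : C)) p = 0.
  have E : f p - f p * 1 = 0 by rewrite mulr1 subrr.
  exact: E.
have Bp : B p = b y0 by rewrite Bin// mulr1.
have -> : (B * B * B : C) p = b y0 ^+ 3 by rewrite !CinfME Bp; ring.
rewrite mulr0 add0r => vE.
apply: (@mulfI _ (b y0 ^+ 3)); first by rewrite expf_neq0.
rewrite vE mulr_sumr; apply: eq_bigr => i _.
have X0p : X0 i p = 0 by rewrite (X0E i).1// /u subrr mxE mulr0.
have DF : 'D_('e_i) F y0 = b y0 * 'D_('e_i) (f \o chart_inv c) y0.
  have dbi := @diff_derivable _ _ _ _ _ 'e_i db.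
  have dfi := @diff_derivable _ _ _ _ _ 'e_i (dc _ (Cinf_smooth f Ac)).
  pose h : 'rV[R]_m -> R := (f \o chart_inv c) - cst (f p).
  have h0 : h y0 = 0.
    have E : f (chart_inv c y0) - f p = 0 by rewrite /y0 chart_mapK// subrr.
    exact: E.
  have dh : derivable h y0 'e_i := derivableB dfi (derivable_cst _ _ _).
  have -> := deriveM dbi dh.
  have -> := deriveB dfi (@derivable_cst _ _ _ (f p) y0 'e_i).
  by rewrite h0 scale0r addr0 derive_cst subr0.
have Yp : Y i p = b y0 * (b y0 * 'D_('e_i) (f \o chart_inv c) y0).
  by rewrite (YE i).1// -/y0 Gy0 DF.
by rewrite vM X0p mul0r addr0 Yp /x vZ; field.
Qed.

End PointDerivation.

(** * Smoothness of the multiplication in product charts and left translations *)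

Section ProductCharts.
Context {R : realType} {m : nat} (G : lieGroupType R m).
Local Notation C := (Cinf G).
Implicit Types (c d : chart R m G) (f h : C) (a x : G).

Lemma row_mxl_is_linear n1 n2 :
  linear (fun y : 'rV[R]_n1 => row_mx y (0 : 'rV[R]_n2)).
Proof.
by move=> a y z; rewrite scale_row_mx add_row_mx scaler0 addr0.
Qed.

Lemma row_mxr_is_linear n1 n2 :
  linear (fun z : 'rV[R]_n2 => row_mx (0 : 'rV[R]_n1) z).
Proof.
by move=> a y z; rewrite scale_row_mx add_row_mx scaler0 addr0.
Qed.

Lemma Ck_on_row_mxl n1 n2 k (U : set 'rV[R]_n1) (z : 'rV[R]_n2) : open U ->
  Ck_on k U (fun y => row_mx y z).
Proof.
move=> oU; pose L : {linear 'rV[R]_n1 -> 'rV[R]_(n1 + n2)} := HB.pack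
  (fun y : 'rV[R]_n1 => row_mx y (0 : 'rV[R]_n2))
  (GRing.isLinear.Build _ _ _ _ _ (@row_mxl_is_linear n1 n2)).
apply: (@Ck_on_ext _ _ _ _ _ ((fun y => row_mx y 0) + cst (row_mx 0 z))) => //.
  move=> y _; transitivity (row_mx y 0 + row_mx 0 z); first by [].
  by rewrite add_row_mx addr0 add0r.
apply: Ck_onD => //; last exact: Ck_on_cst.
exact: (Ck_on_linear k U L).
Qed.

Lemma Ck_on_row_mxr n1 n2 k (U : set 'rV[R]_n2) (y : 'rV[R]_n1) : open U ->
  Ck_on k U (fun z => row_mx y z).
Proof.
move=> oU; pose L : {linear 'rV[R]_n2 -> 'rV[R]_(n1 + n2)} := HB.pack
  (fun y : 'rV[R]_n2 => row_mx (0 : 'rV[R]_n1) y)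
  (GRing.isLinear.Build _ _ _ _ _ (@row_mxr_is_linear n1 n2)).
apply: (@Ck_on_ext _ _ _ _ _ ((fun z => row_mx 0 z) + cst (row_mx y 0))) => //.
  move=> z _; transitivity (row_mx 0 z + row_mx y 0); first by [].
  by rewrite add_row_mx addr0 add0r.
apply: Ck_onD => //; last exact: Ck_on_cst.
exact: (Ck_on_linear k U L).
Qed.

Lemma prod_chart_imE c d (w : 'rV[R]_(m + m)) :
  chart_im (prod_chart c d) w <-> chart_im c (lsubmx w) /\
    chart_im d (rsubmx w).
Proof.
split=> [[[x y] [/= cx dy] <-]|[[x cx xw] [y dy yw]]].
  by rewrite row_mxKl row_mxKr; split; exact: chart_im_map.
by exists (x, y) => //=; rewrite xw yw hsubmxK.
Qed.

Lemma prod_chart_im_open c d : atlas c -> atlas d ->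
  open (chart_im (prod_chart c d)).
Proof.
move=> Ac Ad; rewrite (_ : chart_im _ =
    (lsubmx @^-1` chart_im c) `&` (rsubmx @^-1` chart_im d)); last first.
  by apply/seteqP; split=> w /prod_chart_imE.
apply: openI; apply: open_comp; try exact: chart_im_open.
  by move=> w _; exact: continuous_lsubmx.
by move=> w _; exact: continuous_rsubmx.
Qed.

Lemma prod_chart_open_image c d (O : set (G * G)) : atlas c -> atlas d ->
  open O ->
  open (chart_map (prod_chart c d) @` (chart_dom (prod_chart c d) `&` O)).
Proof.
move=> Ac Ad oO.
rewrite (_ : _ @` _ = chart_im (prod_chart c d) `&`
    chart_inv (prod_chart c d) @^-1` O); last first.
  apply/seteqP; split=> [w [[x y] [[/= cx dy] Oxy] <-]|w [[[x y] [/= cx dy]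
    <-]]].
    split; first by exists (x, y).
    by rewrite /= row_mxKl row_mxKr !chart_mapK.
  by rewrite /= row_mxKl row_mxKr !chart_mapK// => Oxy; exists (x, y).
suff cont : {in chart_im (prod_chart c d),
    continuous (chart_inv (prod_chart c d))}.
  exact: (continuous_inP _ (prod_chart_im_open Ac Ad)).1 cont _ oO.
move=> w /set_mem/prod_chart_imE[cw dw].
have inv_cont (b : chart R m G) y : atlas b -> chart_im b y ->
  {for y, continuous (chart_inv b)}.
  move=> Ab iy; have [_ _ _ _] := atlas_chart Ab.
  rewrite continuous_open_subspace; last exact: chart_im_open.
  by apply; rewrite inE.
have cl := @continuous_comp _ _ _ (@lsubmx R 1 m m) (chart_inv c) w
  (@continuous_lsubmx _ _ _ _ w) (inv_cont _ _ Ac cw).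
have cr := @continuous_comp _ _ _ (@rsubmx R 1 m m) (chart_inv d) w
  (@continuous_rsubmx _ _ _ _ w) (inv_cont _ _ Ad dw).
exact: (cvg_pair cl cr).
Qed.

Definition mul_in_charts f c d (w : 'rV[R]_(m + m)) : R :=
  f (chart_inv c (lsubmx w) * chart_inv d (rsubmx w))%g.

(** Near each point, factor through a chart [b] at the product: [f \o chart_inv b] after the
    coordinate expression of the multiplication. *)
Lemma mul_in_charts_smooth f c d : atlas c -> atlas d ->
  smooth_on (chart_im (prod_chart c d)) (mul_in_charts f c d).
Proof.
move=> Ac Ad k; have [mulC mulS] := @smooth_mul R m G.
apply: Ck_on_local => w /[dup] /prod_chart_imE[cw dw] cdw.
pose mu (p : G * G) := (p.1 * p.2)%g.
have [b Ab bw] := atlas_cover (mu (chart_inv (prod_chart c d) w)).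
have oO : open (mu @^-1` chart_dom b).
  by apply: open_comp => [p _|]; [exact: mulC|exact: open_chart_dom].
pose V := chart_map (prod_chart c d) @`
  (chart_dom (prod_chart c d) `&` mu @^-1` chart_dom b).
have oV : open V by exact: prod_chart_open_image.
have VE z : V z -> chart_dom b (mu (chart_inv (prod_chart c d) z)).
  by move=> [[x y] [[/= cx dy] bxy] <-];
    rewrite /= row_mxKl row_mxKr !chart_mapK.
exists V; split=> //.
  exists (chart_inv c (lsubmx w), chart_inv d (rsubmx w)).
    by split=> //; split; exact: chart_dom_inv.
  by rewrite /= !chart_invK// hsubmxK.
apply: (@Ck_on_ext _ _ _ _ _ ((f \o chart_inv b) \o
    (chart_map b \o mu \o chart_inv (prod_chart c d)))) => //.
  by move=> z /VE bz; rewrite /= chart_mapK.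
apply: (Ck_on_comp oV (chart_im_open Ab)).
- by move=> z /VE bz; exact: chart_im_map.
- apply: mulS => //; exists c => //; exists d => //.
- exact: Cinf_smooth.
Qed.

(** In coordinates this is the restriction of [mul_in_charts] to the slice where the first factor is
    [a]. *)
Lemma left_translate_subproof a f :
  (fun x => f (a * x)%g) \in @smooth_pred R m G.
Proof.
apply/smooth_predP => c Ac k; have [d Ad da] := atlas_cover a.
apply: (@Ck_on_ext _ _ _ _ _
    (mul_in_charts f d c \o (fun z => row_mx (chart_map d a) z))).
- exact: chart_im_open.
- by move=> z cz; rewrite /mul_in_charts/= row_mxKl row_mxKr chart_mapK.
- apply: (Ck_on_comp (chart_im_open Ac) (prod_chart_im_open Ad Ac)).
  + move=> z cz; apply/prod_chart_imE; rewrite row_mxKl row_mxKr.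
    by split=> //; exact: chart_im_map.
  + exact: (Ck_on_row_mxr _ _ (chart_im_open Ac)).
  + exact: mul_in_charts_smooth.
Qed.

Definition left_translate a f : C := MkCinf (left_translate_subproof a f).

End ProductCharts.

(** * Left-invariant extensions of the partial derivatives at the identity *)

Section LeftInvariantFields.
Context {R : realType} {m : nat} (G : lieGroupType R m).
Local Notation C := (Cinf G).
Variables (c : chart R m G) (Ac : atlas c) (c1 : chart_dom c (1%g : G)).
Implicit Types (f h : C) (a x : G).

Let z0 := chart_map c 1%g.

Lemma chart_differentiable (f : C) : differentiable (f \o chart_inv c) z0.
Proof.
have /(_ 1%N)[+ _] := Cinf_smooth f Ac; apply; exact: chart_im_map.
Qed.

(** As a function of [a], this is the derivative of [mul_in_charts] in the direction
    [row_mx 0 'e_i], restricted to the slice where the second coordinate is [z0]. *)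
Lemma left_field_subproof i f :
  (fun a => 'D_('e_i) (left_translate a f \o chart_inv c) z0) \in
    @smooth_pred R m G.
Proof.
apply/smooth_predP => d Ad k.
pose v : 'rV[R]_(m + m) := row_mx 0 'e_i.
apply: (@Ck_on_ext _ _ _ _ _
    ('D_v (mul_in_charts f d c) \o (fun y => row_mx y z0))).
- exact: chart_im_open.
- move=> y dy; rewrite /= /derive.
  apply: (congr1 (fun q : R -> R => lim (q t @[t --> 0^']))).
  apply/funext => t; rewrite /= /mul_in_charts /v scale_row_mx add_row_mx.
  by rewrite !row_mxKl !row_mxKr scaler0 add0r.
- apply: (Ck_on_comp (chart_im_open Ad) (prod_chart_im_open Ad Ac)).
  + move=> y dy; apply/prod_chart_imE; rewrite row_mxKl row_mxKr.
    by split=> //; exact: chart_im_map.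
  + exact: (Ck_on_row_mxl _ _ (chart_im_open Ad)).
  + by have /(_ k.+1)[_] := mul_in_charts_smooth f Ad Ac; exact.
Qed.

Definition left_field_fun i f : C := MkCinf (left_field_subproof i f).

Lemma left_field_derivation i :
  (left_field_fun i : C -> C^o) \in @derivation_pred R m G.
Proof.
apply/derivation_predP; split=> [b f h|f h]; apply: val_inj; apply/funext => a.
  pose F := left_translate a f \o chart_inv c.
  pose H := left_translate a h \o chart_inv c.
  have dF := @diff_derivable _ _ _ F z0 'e_i (chart_differentiable _).
  have dH := @diff_derivable _ _ _ H z0 'e_i (chart_differentiable _).
  have := deriveD (@derivableZ _ _ _ F b _ _ dF) dH;
    rewrite (deriveZ b dF) => E.
  exact: E.
pose F := left_translate a f \o chart_inv c.
pose H := left_translate a h \o chart_inv c.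
have dF := @diff_derivable _ _ _ F z0 'e_i (chart_differentiable _).
have dH := @diff_derivable _ _ _ H z0 'e_i (chart_differentiable _).
have := deriveM dF dH.
have -> : F z0 = f a by rewrite /F /= chart_mapK// mulg1.
have -> : H z0 = h a by rewrite /H /= chart_mapK// mulg1.
move=> E; transitivity ('D_('e_i) (F * H) z0); first by [].
rewrite E addrC [h a *: _]mulrC; by [].
Qed.

Definition left_field i : vfield G := MkVfield (left_field_derivation i).

Lemma left_fieldE i f a :
  left_field i f a = 'D_('e_i) (left_translate a f \o chart_inv c) z0.
Proof. by []. Qed.

Lemma left_field_invariant i : left_invariant (left_field i).
Proof.
move=> a f h hE x; rewrite !left_fieldE; congr ('D_('e_i) _ _).
by apply/funext => z; rewrite /= hE mulgA.
Qed.

Lemma vfield_add (W : vfield G) f h : W (f + h) = W f + W h.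
Proof. by have := vfieldZD W 1 f h; rewrite !scale1r. Qed.

Lemma vfield_scale (W : vfield G) b f : W (b *: f) = b *: (W f : C).
Proof.
have W0 : W 0 = 0.
  by have /eqP := vfield_add W 0 0; rewrite addr0 -subr_eq subrr => /eqP.
by have := vfieldZD W b f 0; rewrite !addr0 W0 addr0.
Qed.

(** This is the tangent vector of [W] at [a] carried back to the identity by left translation. *)
Lemma translated_point_derivation (W : vfield G) a :
  point_derivation (1%g : G) (fun f => W (left_translate a^-1%g f) a).
Proof.
have E0 f : f 1%g = left_translate a^-1%g f a by rewrite /= mulVg.
split=> [f h|b f|f h].
- have -> : left_translate a^-1%g (f + h) =
    left_translate a^-1%g f + left_translate a^-1%g h by exact: val_inj.
  by rewrite vfield_add.
- have -> : left_translate a^-1%g (b *: f) = b *: left_translate a^-1%g f.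
    exact: val_inj.
  by rewrite vfield_scale.
- have -> : left_translate a^-1%g (f * h) =
    left_translate a^-1%g f * left_translate a^-1%g h by exact: val_inj.
  by rewrite vfieldM !E0.
Qed.

(** Evaluation is named to carry a ring morphism structure, which lets it commute with
    determinants. *)
Definition eval_at a (f : C) : R := f a.

Lemma eval_at_is_zmod_morphism a : zmod_morphism (eval_at a).
Proof. by []. Qed.

Lemma eval_at_is_monoid_morphism a : monoid_morphism (eval_at a).
Proof. by []. Qed.

HB.instance Definition _ a :=
  GRing.isZmodMorphism.Build C R (eval_at a) (eval_at_is_zmod_morphism a).
HB.instance Definition _ a :=
  GRing.isMonoidMorphism.Build C R (eval_at a) (eval_at_is_monoid_morphism a).

(** At each [q], [W] is a combination of the left fields with coefficients [k i] not known to be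
    smooth. Applied to the [f j] this is a linear system with matrix [A], and Cramer's rule shows
    that [k i * phi] is the value of the smooth [s i]. *)
Lemma left_fields_span (W : vfield G) a : exists (phi : C) (s : 'I_m -> C),
  phi a != 0 /\ phi *: W = \sum_i s i *: left_field i.
Proof.
have [x [xD xE]] := point_derivation_coordinates Ac c1.
(* These are the coordinates at 1 moved to [a], so that [A] is the identity matrix at [a]. *)
pose f j := left_translate a^-1%g (x j).
pose A : 'M[C]_m := \matrix_(i, j) left_field i (f j).
pose phi := \det A.
pose s i := \sum_j (W (f j) : C) * \adj A j i.
exists phi, s; split.
  have -> : phi a = \det (map_mx (eval_at a) A) by rewrite det_map_mx.
  have -> : map_mx (eval_at a) A = 1%:M; last by rewrite det1 oner_neq0.
  apply/matrixP => i j; rewrite !mxE [LHS]left_fieldE eq_sym -xD.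
  by congr ('D_('e_i) _ _); apply/funext => z; rewrite /= mulKg.
have kappa q h : W h q =
  \sum_i W (left_translate q^-1%g (x i)) q * left_field i h q.
  have := xE _ (left_translate q h) (translated_point_derivation W q).
  have -> // : left_translate q^-1%g (left_translate q h) = h.
  by apply: val_inj; apply/funext => y; rewrite /= mulVKg.
apply: val_inj; apply/funext => h; apply: val_inj; apply/funext => q.
have sumE (X : 'I_m -> vfield G) : (\sum_i X i) h q = \sum_i X i h q.
  by elim/big_ind2: _ => // X1 u1 X2 u2 <- <-.
pose k i := W (left_translate q^-1%g (x i)) q.
have sq i : s i q = k i * phi q.
  rewrite Cinf_sumE (eq_bigr (fun j =>
    \sum_l k l * (A l j * \adj A j i) q)); last first.
    move=> j _; rewrite CinfME kappa mulr_suml; apply: eq_bigr => l _.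
    by rewrite -mulrA [in RHS]CinfME [A l j]mxE.
  have AE l : \sum_j (A l j * \adj A j i) q = phi q *+ (l == i).
    have := congr1 (fun B : 'M[C]_m => B l i q) (mul_mx_adj A).
    by rewrite !mxE Cinf_sumE => ->; case: (l == i).
  rewrite exchange_big/= (bigD1 i)//= [X in _ + X]big1 => [|l li].
    by rewrite addr0 -mulr_sumr AE eqxx.
  by rewrite -mulr_sumr AE (negbTE li) mulr0.
transitivity (phi q * W h q); first by [].
rewrite [RHS]sumE kappa mulr_sumr; apply: eq_bigr => i _.
transitivity (s i q * left_field i h q); last by [].
by rewrite sq mulrCA mulrA.
Qed.

End LeftInvariantFields.

(** * A basis of the Lie algebra as a frame for vector fields *)

Section Frames.
Context {R : realType} {m : nat} (G : lieGroupType R m).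
Local Notation C := (Cinf G).
Variables (n : nat) (E : 'I_n -> vfield G) (hE : lie_algebra_basis E).
Implicit Types (X Y Z W : vfield G).

Lemma basis_span W a : exists (phi : C) (t : 'I_n -> C),
  phi a != 0 /\ phi *: W = \sum_j t j *: E j.
Proof.
have [c Ac c1] := atlas_cover (1%g : G).
have [phi [s [phia sE]]] := left_fields_span Ac c1 W a.
have /choice[b bE] : forall i, exists b : 'I_n -> R,
    left_field Ac c1 i = \sum_j (b j *: (1 : C)) *: E j.
  move=> i; have [b [bE _]] := hE.2 _ (left_field_invariant Ac c1 i).
  by exists b.
exists phi, (fun j => \sum_i s i * (b i j *: (1 : C))); split=> //.
rewrite sE; under eq_bigr do rewrite bE scaler_sumr.
rewrite exchange_big; apply: eq_bigr => j _; rewrite scaler_suml.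
by apply: eq_bigr => i _; rewrite scalerA.
Qed.

(** At a point [a], choose [phi] with [phi a != 0] and [phi *: X] in the span of [E]; then
    [phi * theta X = 0], and [phi a] cancels. *)
Lemma linear_basis_eq0 (theta : vfield G -> C) :
  (forall (f : C) X Y, theta (f *: X + Y) = f * theta X + theta Y) ->
  (forall i, theta (E i) = 0) -> forall X, theta X = 0.
Proof.
move=> thetaZD thetaE X; apply: val_inj; apply/funext => a.
have thetaD Y Z : theta (Y + Z) = theta Y + theta Z.
  by have := thetaZD 1 Y Z; rewrite scale1r mul1r.
have theta0 : theta 0 = 0.
  by have /eqP := thetaD 0 0; rewrite addr0 -subr_eq subrr => /eqP.
have thetaZ f Y : theta (f *: Y) = f * theta Y.
  by have := thetaZD f Y 0; rewrite !addr0 theta0 addr0.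
have [phi [t [phia tE]]] := basis_span X a.
have : phi * theta X = 0.
  rewrite -thetaZ tE (big_morph theta thetaD theta0) big1// => j _.
  by rewrite thetaZ thetaE mulr0.
move=> /(congr1 (eval_at a)) /eqP; rewrite [X in X == _]/(phi a * theta X a).
by rewrite mulf_eq0 (negbTE phia) => /eqP.
Qed.

(** * The weak Frobenius condition and Koszul's formula on the basis *)

Variable g : riemannian_metric G.

Lemma metricZDl (f : C) X Y Z : g (f *: X + Y) Z = f * g X Z + g Y Z.
Proof. by rewrite metricC metricZD [g Z X]metricC [g Z Y]metricC. Qed.

Lemma metricBl X Y Z : g (X - Y) Z = g X Z - g Y Z.
Proof. by rewrite -scaleN1r addrC metricZDl mulN1r addrC. Qed.

(** The difference of the two sides is linear over smooth functions in each argument, so the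
    arguments are replaced by basis fields one at a time. *)
Lemma weak_frobenius_basis (B : tensor12 G) :
  weak_frobenius g B <->
  forall i j k, g (B (E i) (E j)) (E k) = g (E i) (B (E j) (E k)).
Proof.
split=> [BF i j k|BE X Y Z]; first exact: BF.
apply/eqP; rewrite -subr_eq0; apply/eqP; move: X.
apply: linear_basis_eq0 => [f X X'|i].
  by rewrite tensorZDl !metricZDl mulrBr opprD addrACA.
move: Y; apply: linear_basis_eq0 => [f Y Y'|j].
  by rewrite tensorZDr tensorZDl metricZDl metricZD mulrBr opprD addrACA.
move: Z; apply: linear_basis_eq0 => [f Z Z'|k].
  by rewrite tensorZDr !metricZD mulrBr opprD addrACA.
by rewrite BE subrr.
Qed.

Let c i j k := g (E i) (bracket (E j) (E k)).

(* The six difference tensors all have this shape, with [(alpha, beta)] among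
   [(1, 0)], [(+-1/2, 0)], [(0, 1/2)], [(+-1/2, 1/2)]. The cyclic conditions for
   [(i,j,k)] and [(j,k,i)] form a linear system in two differences of values of
   [c], of determinant [alpha^2 + 3 beta^2]. *)
Lemma weak_frobenius_cyclic (B : tensor12 G) (alpha beta : R) :
  alpha ^+ 2 + 3 * beta ^+ 2 != 0 ->
  (forall i j k x, g (B (E i) (E j)) (E k) x =
     alpha * c k i j x + beta * (c i j k x - c j k i x)) ->
  weak_frobenius g B <-> forall i j k, c i j k = c j k i.
Proof.
move=> ab BE; rewrite weak_frobenius_basis; split=> [BF|cyc] i j k;
  apply: val_inj; apply/funext => x.
  have := congr1 (eval_at x) (BF i j k); have := congr1 (eval_at x) (BF j k i).
  rewrite /eval_at [g (E i) _]metricC [g (E j) _]metricC !BE => e2 e1.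
  suff uniq (u v w : R) :
      alpha * w + beta * (u - v) = alpha * u + beta * (v - w) ->
      alpha * u + beta * (v - w) = alpha * v + beta * (w - u) -> u = v.
    exact: uniq e1 e2.
  move=> {}e1 {}e2; have uv : (alpha ^+ 2 + 3 * beta ^+ 2) * (u - v) = 0.
    (* The multipliers eliminate [w], whose coefficients in the two differences are [alpha + beta]
       and [- 2 * beta]. *)
    transitivity (2 * beta * ((alpha * w + beta * (u - v)) -
      (alpha * u + beta * (v - w))) + (alpha + beta) *
      ((alpha * u + beta * (v - w)) - (alpha * v + beta * (w - u))));
        first ring.
    by rewrite e1 e2 !subrr !mulr0 addr0.
  by move/eqP: uv; rewrite mulf_eq0 (negbTE ab) subr_eq0 => /eqP.
have cycx i' j' k' : c i' j' k' x = c j' k' i' x by rewrite cyc.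
have -> : val (g (E i) (B (E j) (E k))) = val (g (B (E j) (E k)) (E i)).
  by rewrite metricC.
by rewrite [LHS]BE [RHS]BE (cycx i j k) (cycx j k i).
Qed.

(** Derivations kill constants; this applies to the values of [g (E i) (E j)] on an orthonormal
    basis. *)
Lemma vfield_natr W (b : bool) : W b%:R = 0.
Proof.
have W1 : W 1 = 0.
  have /eqP := vfieldM W 1 1.
  by rewrite !mulr1 mul1r -subr_eq subrr eq_sym => /eqP.
have W0 : W 0 = 0.
  by have /eqP := vfield_add W 0 0; rewrite addr0 -subr_eq subrr => /eqP.
by case: b.
Qed.

(** Orthonormality removes the derivative terms, so compatibility says that
    [g (nabla (E i) (E j)) (E k)] is antisymmetric in [j] and [k]. Three such relations and three
    torsion relations determine it linearly. *)
Lemma koszul (nabla : connection G) : levi_civita g nabla ->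
  (forall i j, g (E i) (E j) = (i == j)%:R) ->
  forall i j k x, g (nabla (E i) (E j)) (E k) x =
    2^-1 * (c k i j x - c i j k x + c j k i x).
Proof.
move=> [tor comp] orth i j k x.
have torE i' j' k' : g (nabla (E i') (E j')) (E k') x -
    g (nabla (E j') (E i')) (E k') x = c k' i' j' x.
  by have := congr1 (fun V => g V (E k') x) (tor (E i') (E j'));
    rewrite metricBl [g (bracket _ _) _]metricC.
have compE i' j' k' : g (nabla (E i') (E j')) (E k') x +
    g (nabla (E i') (E k')) (E j') x = 0.
  have := congr1 (eval_at x) (comp (E i') (E j') (E k')).
  by rewrite orth vfield_natr [g (E j') _]metricC.
have := torE i j k; have := torE j k i; have := torE k i j.
have := compE i j k; have := compE j i k; have := compE k i j.
lra.
Qed.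

End Frames.

(** * The six differences of the Cartan-Schouten and Levi-Civita connections *)

Theorem proposition3p4 (R : realType) (m : nat) (G : lieGroupType R m)
    (n : nat) (E : 'I_n -> vfield G) (hE : lie_algebra_basis E)
    (g : riemannian_metric G)
    (hg : forall i j : 'I_n, g (E i) (E j) = (i == j)%:R)
    (nabla : connection G) (hnabla : levi_civita g nabla)
    (nabla_bar nabla_plus nabla_circ : connection G)
    (hbar : forall i j : 'I_n, nabla_bar (E i) (E j) = 0)
    (hplus : forall i j : 'I_n, nabla_plus (E i) (E j) = bracket (E i) (E j))
    (hcirc : forall i j : 'I_n, nabla_circ (E i) (E j) =
       (2^-1 *: (1 : Cinf G)) *: bracket (E i) (E j)) :
  let A_bar := conn_diff nabla_bar nabla_circ in
  let A_plus := conn_diff nabla_plus nabla_circ in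
  let A := conn_diff nabla_plus nabla_bar in
  let A_plus' := conn_diff nabla_plus nabla in
  let A' := conn_diff nabla_circ nabla in
  let A_bar' := conn_diff nabla_bar nabla in
  let ad_cyclic := forall i j k : 'I_n,
    g (E i) (bracket (E j) (E k)) = g (E j) (bracket (E k) (E i)) in
  (weak_frobenius g A <-> ad_cyclic) /\
  (weak_frobenius g A_plus <-> ad_cyclic) /\
  (weak_frobenius g A_bar <-> ad_cyclic) /\
  (weak_frobenius g A_bar' <-> ad_cyclic) /\
  (weak_frobenius g A_plus' <-> ad_cyclic) /\
  (weak_frobenius g A' <-> ad_cyclic).
Proof.
move=> A_bar A_plus A A_plus' A' A_bar' ad_cyclic.
have scaleE X Y x : g ((2^-1 *: (1 : Cinf G)) *: X) Y x = 2^-1 * g X Y x.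
  have := congr1 (eval_at x) (metricZDl g (2^-1 *: (1 : Cinf G)) X 0 Y).
  have -> : g 0 Y = 0 by rewrite -(subrr X) metricBl subrr.
  rewrite !addr0 => E1.
  by transitivity (2^-1 * 1 * g X Y x); [exact: E1|rewrite mulr1].
have bracketE i j k : g (bracket (E i) (E j)) (E k) =
  g (E k) (bracket (E i) (E j)).
  exact: metricC.
have subE X Y Z x : g (X - Y) Z x = g X Z x - g Y Z x by rewrite metricBl.
have zeroE Z x : g 0 Z x = 0 by rewrite -(subrr Z) subE subrr.
have kz := koszul hnabla hg.
have sq (a b : R) : 0 < a ^+ 2 + 3 * b ^+ 2 -> a ^+ 2 + 3 * b ^+ 2 != 0.
  by move=> /lt0r_neq0.
(* A multiple of the bracket contributes its factor to [alpha], and subtracting [nabla] contributes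
   [(- 2^-1, 2^-1)] to the pair by Koszul's formula. *)
split; [|split; [|split; [|split; [|split]]]].
- apply: (@weak_frobenius_cyclic _ _ _ _ _ hE g A 1 0); first by apply: sq; lra.
  by move=> i j k x; rewrite /= subE hplus hbar zeroE bracketE; lra.
- apply: (@weak_frobenius_cyclic _ _ _ _ _ hE g A_plus 2^-1 0);
  first by apply: sq; lra.
  by move=> i j k x; rewrite /= subE hplus hcirc scaleE bracketE; lra.
- apply: (@weak_frobenius_cyclic _ _ _ _ _ hE g A_bar (- 2^-1) 0);
  first by apply: sq; lra.
  by move=> i j k x; rewrite /= subE hbar hcirc scaleE zeroE bracketE; lra.
- apply: (@weak_frobenius_cyclic _ _ _ _ _ hE g A_bar' (- 2^-1) 2^-1);
  first by apply: sq; lra.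
  by move=> i j k x; rewrite /= subE hbar zeroE kz; lra.
- apply: (@weak_frobenius_cyclic _ _ _ _ _ hE g A_plus' 2^-1 2^-1);
  first by apply: sq; lra.
  by move=> i j k x; rewrite /= subE hplus kz bracketE; lra.
- apply: (@weak_frobenius_cyclic _ _ _ _ _ hE g A' 0 2^-1);
  first by apply: sq; lra.
  by move=> i j k x; rewrite /= subE hcirc scaleE kz bracketE; lra.
Qed.
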